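(* Let $A$ and $B$ be commutative rings with identity, $f:A\rightarrow B$ a ring homomorphism, and $J$ an ideal of $B$ contained in the nil-radical $\mathrm{Nil}(B)$. Let $A\bowtie^fJ$ be the amalgamation of $A$ with $B$ along $J$ with respect to $f$, and regard $J$ as an $A$-module via $f$. Then $$\mathrm{fPD}(A\bowtie^fJ)=\sup\{\min\{\mathrm{K.grade}_{A}(\mathfrak{m},A),\mathrm{K.grade}_{A}(\mathfrak{m},J)\}\mid \mathfrak{m}\in\mathrm{Max}(A)\}\leq \mathrm{fPD}(A).$$
   Context: $\mathrm{Max}(A)$ is the set of maximal ideals of $A$; $\mathrm{Nil}(B)$ is the nil-radical of $B$. Amalgamation: $A\bowtie^fJ=\{(a,f(a)+j)\mid a\in A,\ j\in J\}$, a subring of $A\times B$. Small finitistic dimension: for a commutative ring $S$, an $S$-module $N$ has a finite projective resolution if there are an integer $n$ and an exact sequence $0\to P_n\to P_{n-1}\to\cdots\to P_1\to P_0\to N\to 0$ with every $P_i$ a finitely generated projective $S$-module. $\mathrm{fPD}(S)$ is the supremum of the projective dimensions of all $S$-modules having a finite projective resolution (possibly $\infty$). Koszul grade: for a finite sequence $\mathbf{x}=x_1,\dots,x_n$ in $A$, let $K_\bullet(\mathbf{x})$ be the Koszul complex of $\mathbf{x}$ over $A$, and for an $A$-module $N$ let $\mathrm{H}^p(\mathbf{x},N)$ be the $p$-th cohomology of the complex $\mathrm{Hom}_A(K_\bullet(\mathbf{x}),N)$. If $I$ is the ideal generated by $\mathbf{x}$, put $\mathrm{K.grade}_A(I,N)=\inf\{p\in\mathbb{N}\mid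 \mathrm{H}^p(\mathbf{x},N)\neq 0\}$ (with $\mathbb{N}\ni 0$ and $\inf\emptyset=\infty$); this does not depend on the choice of finite generating sequence of $I$. For an arbitrary ideal $L$ of $A$, put $\mathrm{K.grade}_A(L,N)=\sup\{\mathrm{K.grade}_A(I,N)\mid I\subseteq L \text{ a finitely generated ideal of } A\}$. *)

(* Defs.v *)
From HB Require Import structures.
From mathcomp Require Import all_boot all_order all_algebra.
From mathcomp Require Import boolp classical_sets.

Set Implicit Arguments.
Unset Strict Implicit.
Unset Printing Implicit Defensive.

Import Order.TTheory GRing.Theory.
Local Open Scope ring_scope.
Local Open Scope classical_set_scope.

Inductive enat := ENat of nat | EInfty.

Definition enat_opt (x : enat) : option nat :=
  if x is ENat n then Some n else None.
Definition opt_enat (o : option nat) : enat :=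
  if o is Some n then ENat n else EInfty.
Lemma enat_optK : cancel enat_opt opt_enat. Proof. by case. Qed.

HB.instance Definition _ := Choice.copy enat (can_type enat_optK).

Definition enat_le (x y : enat) : bool :=
  match x, y with
  | _, EInfty => true
  | EInfty, ENat _ => false
  | ENat m, ENat n => (m <= n)%N
  end.

Lemma enat_le_refl : reflexive enat_le.
Proof. by case=> //= n; rewrite leqnn. Qed.

Lemma enat_le_anti : antisymmetric enat_le.
Proof. by case=> [m|] [n|] //= /anti_leq ->. Qed.

Lemma enat_le_trans : transitive enat_le.
Proof. by case=> [n|] [m|] [p|] //=; apply: leq_trans. Qed.

Lemma enat_le_total : total enat_le.
Proof. by case=> [m|] [n|] //=; apply: leq_total. Qed.

Fact enat_display : Order.disp_t. Proof. exact: Order.Disp tt tt. Qed.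

HB.instance Definition _ :=
  Order.Le_isPOrder.Build enat_display enat
    enat_le_refl enat_le_anti enat_le_trans.
HB.instance Definition _ :=
  Order.POrder_isTotal.Build enat_display enat enat_le_total.

(* sup of the empty set is 0 and inf of the empty set is infinity, as
   usual for subsets of the extended natural numbers *)
Definition esup (E : set enat) : enat := supremum (ENat 0) E.
Definition einf (E : set enat) : enat := infimum EInfty E.

Lemma enat_infimums_neq0 (E : set enat) : infimums E !=set0.
Proof.
have [[n0 En0]|noE] := pselect (exists n, E (ENat n)); last first.
  exists EInfty; split=> [[n|] Ex|y _] //; first by case: noE; exists n.
  by case: y.
have exE : exists n, `[< E (ENat n) >] by exists n0; apply/asboolP.
case: (ex_minnP exE) => n /asboolP En nmin; exists (ENat n); split.
  by case=> [m|] Em //; apply: nmin; apply/asboolP.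
by move=> y; apply.
Qed.

Lemma enat_supremums_neq0 (E : set enat) : supremums E !=set0.
Proof.
have [x [xlb xglb]] := enat_infimums_neq0 (ubound E).
by exists x; split=> [y Ey|y]; [apply: xglb => z; apply | exact: xlb].
Qed.

Lemma esup_ub (E : set enat) x : E x -> (x <= esup E)%O.
Proof. exact/ge_supremum_Nmem/enat_supremums_neq0. Qed.

Lemma esup_least (E : set enat) y :
  (forall x, E x -> (x <= y)%O) -> (esup E <= y)%O.
Proof.
move=> Ey; rewrite /esup /supremum; case: ifP => _; first by case: y Ey.
by case: xgetP => [z _ [_]|nE]; [apply | have [z /nE] := enat_supremums_neq0 E].
Qed.

Lemma einf_lb (E : set enat) x : E x -> (einf E <= x)%O.
Proof. exact/le_infimum_Nmem/enat_infimums_neq0. Qed.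

Lemma einf_greatest (E : set enat) y :
  (forall x, E x -> (y <= x)%O) -> (y <= einf E)%O.
Proof.
move=> Ey; rewrite /einf /infimum; case: ifP => _; first by case: y Ey.
by case: xgetP => [z _ [_]|nE]; [apply | have [z /nE] := enat_infimums_neq0 E].
Qed.

(* The ideals of ring_quotient are proper ideals of nontrivial rings, whereas
   here improper ideals (and the zero ring) are allowed. *)
Record ideal (R : comPzRingType) := Ideal {
  ideal_set :> set R;
  ideal_0 : ideal_set 0;
  ideal_D : forall x y, ideal_set x -> ideal_set y -> ideal_set (x + y);
  ideal_M : forall a x, ideal_set x -> ideal_set (a * x) }.

Definition maximal_ideal (R : comPzRingType) (m : ideal R) : Prop :=
  ~ ideal_set m 1 /\ forall I : ideal R, m `<=` I -> ~ ideal_set I 1 -> I `<=` m.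

Definition Max (R : comPzRingType) : set (ideal R) := [set m | maximal_ideal m].

Definition nilradical (R : comPzRingType) : set R :=
  [set x | exists n : nat, x ^+ n = 0].

Definition generates (R : comPzRingType) (I : ideal R) n (x : 'I_n -> R) : Prop :=
  forall a, ideal_set I a <-> exists c : 'I_n -> R, a = \sum_i c i * x i.

Definition fg_ideal (R : comPzRingType) (I : ideal R) : Prop :=
  exists n (x : 'I_n -> R), generates I x.

Definition exact_at (S : comPzRingType) (L M N : lmodType S)
    (g : {linear L -> M}) (h : {linear M -> N}) : Prop :=
  forall y, h y = 0 <-> exists x, g x = y.

Definition surjective_map T U (g : T -> U) : Prop := forall y, exists x, g x = y.

Definition projective (S : comPzRingType) (P : lmodType S) : Prop :=
  forall (M N : lmodType S) (g : {linear M -> N}) (h : {linear P -> N}),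
    surjective_map g -> exists k : {linear P -> M}, forall x, g (k x) = h x.

Definition fg_module (S : comPzRingType) (M : lmodType S) : Prop :=
  exists n (g : 'I_n -> M), forall x, exists c : 'I_n -> S, x = \sum_i c i *: g i.

(* An exact sequence 0 -> P_n -> ... -> P_0 -> N -> 0 with every P_i satisfying
   C is encoded as an infinite one whose terms of index > n vanish. *)
Definition has_resolution (S : comPzRingType) (C : lmodType S -> Prop)
    (N : lmodType S) (n : nat) : Prop :=
  exists (P : nat -> lmodType S) (d : forall i, {linear P i.+1 -> P i})
         (e : {linear P 0 -> N}),
    [/\ forall i, (i <= n)%N -> C (P i),
        forall i, (n < i)%N -> forall x : P i, x = 0,
        surjective_map e,
        exact_at (d 0) e
      & forall i, exact_at (d i.+1) (d i)].

Definition has_finite_projective_resolution (S : comPzRingType)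
    (N : lmodType S) : Prop :=
  exists n, has_resolution (fun P => fg_module P /\ projective P) N n.

Definition projdim (S : comPzRingType) (N : lmodType S) : enat :=
  einf [set ENat n | n in [set n | has_resolution (@projective S) N n]].

Definition fPD (S : comPzRingType) : enat :=
  esup [set k | exists N : lmodType S,
    has_finite_projective_resolution N /\ k = projdim N].

Section Koszul.
Variables (A : comPzRingType) (n : nat) (x : 'I_n -> A).

(* The degree p part of the Koszul complex: the free module on the basis
   e_S = e_i1 /\ ... /\ e_ip, for S = {i1 < ... < ip}. *)
Definition koszul_basis p := {S : {set 'I_n} | #|S| == p}.
Definition koszul p : lmodType A := {ffun koszul_basis p -> A^o}.

(* d (e_S) = \sum_(i in S) (-1)^(number of j in S with j < i) x_i e_(S \ i) *)
Definition koszul_d_fun p (u : koszul p.+1) : koszul p :=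
  [ffun T : koszul_basis p =>
    \sum_(S : koszul_basis p.+1)
      \sum_(i in val S | val S :\ i == val T)
        (-1) ^+ #|[set j in val S | (j < i)%N]| * x i * u S].

Fact koszul_d_is_linear p : linear (@koszul_d_fun p).
Proof.
move=> a u v; apply/ffunP=> T; rewrite !ffunE scaler_sumr -big_split /=.
apply: eq_bigr => S _; rewrite scaler_sumr -big_split /=.
apply: eq_bigr => i _; rewrite !ffunE mulrDr; congr (_ + _).
by rewrite /GRing.scale /= mulrCA.
Qed.

HB.instance Definition _ p :=
  GRing.isLinear.Build A (koszul p.+1) (koszul p) _ (@koszul_d_fun p)
    (@koszul_d_is_linear p).

Definition koszul_d p : {linear koszul p.+1 -> koszul p} := @koszul_d_fun p.

Variable N : lmodType A.

Definition koszul_cocycle p (phi : {linear koszul p -> N}) : Prop :=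
  forall u, phi (koszul_d p u) = 0.

(* In degree 0 the incoming map is zero, so the only coboundary is 0. *)
Definition koszul_coboundary p : {linear koszul p -> N} -> Prop :=
  if p is q.+1 then
    fun phi => exists psi : {linear koszul q -> N},
      forall u, phi u = psi (koszul_d q u)
  else fun phi => forall u, phi u = 0.

Definition koszul_cohomology_neq0 p : Prop :=
  exists phi : {linear koszul p -> N},
    koszul_cocycle phi /\ ~ koszul_coboundary phi.

Definition Kgrade_seq : enat :=
  einf [set ENat p | p in koszul_cohomology_neq0].

End Koszul.

(* The value Kgrade_seq x N depends only on the ideal generated by x, so all
   generating sequences of I contribute the same element to the supremum. *)
Definition Kgrade (A : comPzRingType) (L : ideal A) (N : lmodType A) : enat :=
  esup [set k | exists I : ideal A, [/\ fg_ideal I, I `<=` L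
    & exists n (x : 'I_n -> A), generates I x /\ k = Kgrade_seq x N]].

Section Amalgamation.
Variables (A B : comPzRingType) (f : {rmorphism A -> B}) (J : ideal B).

Definition amalg_pred : {pred (A * B)%type} :=
  fun p => `[< exists a j, ideal_set J j /\ p = (a, f a + j) >].

Fact amalg_subring : subring_closed amalg_pred.
Proof.
split=> [|_ _ /asboolP[a [j [Jj ->]]] /asboolP[b [k [Jk ->]]]
         |_ _ /asboolP[a [j [Jj ->]]] /asboolP[b [k [Jk ->]]]]; apply/asboolP.
- by exists 1, 0; rewrite rmorph1 addr0; split=> //; apply: ideal_0.
- exists (a - b), (j + (-1) * k); split.
    by apply: ideal_D => //; apply: ideal_M.
  by rewrite mulN1r rmorphB [LHS]/GRing.add /= /add_pair /= opprD addrACA.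
- exists (a * b), (f a * k + (f b + k) * j); split.
    by apply: ideal_D; apply: ideal_M.
  rewrite rmorphM [LHS]/GRing.mul /= /mul_pair /=; congr (_, _).
  by rewrite mulrDl mulrDr addrA [j * _]mulrC.
Qed.

HB.instance Definition _ :=
  GRing.isSubringClosed.Build (A * B)%type amalg_pred amalg_subring.

Definition amalgamation := {p : A * B | p \in amalg_pred}.

HB.instance Definition _ := SubChoice.on amalgamation.
HB.instance Definition _ :=
  GRing.SubChoice_isSubComPzRing.Build (A * B)%type amalg_pred amalgamation
    amalg_subring.

Definition ideal_pred : {pred B} := fun b => `[< ideal_set J b >].

Fact ideal_pred_zmod : zmod_closed ideal_pred.
Proof.
split=> [|x y /asboolP Jx /asboolP Jy]; apply/asboolP; first exact: ideal_0.
by rewrite -mulN1r; apply: ideal_D => //; apply: ideal_M.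
Qed.

HB.instance Definition _ :=
  GRing.isZmodClosed.Build B ideal_pred ideal_pred_zmod.

(* f is a phantom argument, it determines the A-module structure below *)
Definition ideal_module of {rmorphism A -> B} := {b : B | b \in ideal_pred}.
Local Notation M := (ideal_module f).

HB.instance Definition _ := SubChoice.on M.
HB.instance Definition _ := [SubChoice_isSubZmodule of M by <:].

Fact ideal_scale_subproof (a : A) (u : M) : f a * val u \in ideal_pred.
Proof. by apply/asboolP; apply: ideal_M; apply/asboolP; exact: (valP u). Qed.

Definition ideal_scale (a : A) (u : M) : M :=
  Sub (f a * val u) (ideal_scale_subproof a u).

Fact ideal_scaleA a b v : ideal_scale a (ideal_scale b v) = ideal_scale (a * b) v.
Proof. by apply: val_inj; rewrite /= rmorphM mulrA. Qed.
Fact ideal_scale1 : left_id 1 ideal_scale.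
Proof. by move=> v; apply: val_inj; rewrite /= rmorph1 mul1r. Qed.
Fact ideal_scaleDr : right_distributive ideal_scale +%R.
Proof. by move=> a u v; apply: val_inj; rewrite /= mulrDr. Qed.
Fact ideal_scaleDl v : {morph ideal_scale^~ v : a b / a + b}.
Proof. by move=> a b; apply: val_inj; rewrite /= rmorphD mulrDl. Qed.

HB.instance Definition _ := GRing.Zmodule_isLmodule.Build A M
  ideal_scaleA ideal_scale1 ideal_scaleDr ideal_scaleDl.

End Amalgamation.

(* Main.v *)
(* For every commutative ring S, fPD(S) is the supremum of the Koszul grades
   K.grade(x, S) over finite sequences x generating a proper ideal.

   If H^p(x, S) = 0 for p < k, the Koszul cochain complex truncated at degree k
   is a free resolution of length k of a module N.  If N had projective
   dimension < k, comparing resolutions would split S = K^0 -> K^1, whose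
   entries are the x_i, so that 1 would lie in (x).

   Conversely, let P be a resolution of minimal length k > 0 by finitely
   generated projectives.  As d : P_k -> P_{k-1} does not split, it is not
   injective modulo some maximal ideal m: there are v in P_k and a functional
   lam such that the coordinates x_j of d v and u = 1 - lam v lie in m.  Let z
   be a sequence whose radical contains u and the x_j, and suppose
   H^p(z, S) = 0 for p < g, where g < k.  Dimension shifting along P shows that
   H^g(z, P_k) -> H^g(z, P_{k-1}) is injective.  Hence a class c of H^g(z, S)
   killed by u and all x_j vanishes: d (c v) = 0 gives c v = 0, and then
   c = lam (c v) = 0.  Since u and the x_j act nilpotently, H^g(z, S) = 0.

   For S the amalgamation and J nil, z may be taken in the image of A, because
   the kernel of the projection to A is nil.  As S is A (+) J over A, the
   vanishing of H^p(z, S) amounts to that of H^p(z, A) and H^p(z, J). *)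

Require Import Defs.
From HB Require Import structures.
From mathcomp Require Import boolp classical_sets.
From mathcomp Require Import all_boot all_order all_algebra.
From mathcomp Require Import ring generic_quotient.

Set Implicit Arguments.
Unset Strict Implicit.
Unset Printing Implicit Defensive.

Import Order.TTheory GRing.Theory.
Local Open Scope ring_scope.

(** * Free and projective modules *)

Section FreeModule.
Variables (A : comPzRingType) (T : finType) (M : lmodType A).
Implicit Types (g : T -> M) (u : {ffun T -> A^o}).

Definition free_comb_fun g u : M := \sum_t (u t : A) *: g t.

Fact free_comb_is_linear g : linear (free_comb_fun g).
Proof.
move=> a u v; rewrite scaler_sumr -big_split; apply: eq_bigr => t _ /=.
by rewrite !ffunE scalerDl scalerA.
Qed.

HB.instance Definition _ g := GRing.isLinear.Build A {ffun T -> A^o} M _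
  (free_comb_fun g) (free_comb_is_linear g).

Definition free_comb g : {linear {ffun T -> A^o} -> M} := free_comb_fun g.

Definition free_basis (t : T) : {ffun T -> A^o} := [ffun s => (s == t)%:R].

Lemma free_comb_basis g t : free_comb g (free_basis t) = g t.
Proof.
rewrite /= /free_comb_fun (bigD1 t) //= big1 ?addr0 => [|s st].
  by rewrite ffunE eqxx scale1r.
by rewrite ffunE (negPf st) scale0r.
Qed.

Lemma free_basisE u : u = \sum_t (u t : A) *: free_basis t.
Proof.
apply/ffunP=> s; rewrite sum_ffunE (bigD1 s) //= big1 ?addr0.
  by rewrite !ffunE eqxx [RHS]mulr1.
by move=> t ts; rewrite !ffunE eq_sym (negPf ts) [LHS]mulr0.
Qed.

Lemma free_combE (h : {linear {ffun T -> A^o} -> M}) u :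
  h u = free_comb (fun t => h (free_basis t)) u.
Proof.
by rewrite {1}[u]free_basisE linear_sum; apply: eq_bigr => t _; rewrite linearZ.
Qed.

End FreeModule.

Lemma free_projective (A : comPzRingType) (T : finType) :
  projective ({ffun T -> A^o} : lmodType A).
Proof.
move=> M N g h gs; have /choice[k kE] t := gs (h (free_basis A t)).
exists (free_comb k) => u; rewrite [RHS]free_combE linear_sum.
by apply: eq_bigr => t _; rewrite linearZ /= kE.
Qed.

Lemma free_fg (A : comPzRingType) (T : finType) :
  fg_module ({ffun T -> A^o} : lmodType A).
Proof.
exists #|T|, (fun i => free_basis A (enum_val i)) => u.
exists (fun i => u (enum_val i)); rewrite {1}[u]free_basisE.
by rewrite (reindex (@enum_val T T)) //; apply: onW_bij (enum_val_bij T).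
Qed.

Section Modules.
Variable A : comPzRingType.
Implicit Types (M N P L : lmodType A).

Definition fg_projective P := fg_module P /\ projective P.

(** Projectivity splits the surjection from a free module given by finitely many generators; the
    functionals are the coordinates of the splitting. *)
Lemma dual_basis P : fg_projective P ->
  exists m (g : 'I_m -> P) (phi : 'I_m -> {linear P -> A^o}),
    forall v, v = \sum_i (phi i v : A) *: g i.
Proof.
move=> [[m [g gP]] Pproj].
have [|k kE] := Pproj _ _ (free_comb g) idfun.
  by move=> v; have [c ->] := gP v; exists [ffun i => c i];
     apply: eq_bigr => i _; rewrite ffunE.
pose phi i v : A^o := k v i.
have phi_lin i : linear (phi i) by move=> a u v; rewrite /phi linearP !ffunE.
pose Phi i : {linear P -> A^o} :=
  HB.pack (phi i) (GRing.isLinear.Build A P A^o _ (phi i) (phi_lin i)).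
by exists m, g, Phi => v; rewrite -[LHS](kE v).
Qed.

Lemma fg_surj M N (g : {linear M -> N}) :
  surjective_map g -> fg_module M -> fg_module N.
Proof.
move=> gs [n [b bP]]; exists n, (g \o b) => y; have [x <-] := gs y.
by have [c ->] := bP x; exists c; rewrite linear_sum; apply: eq_bigr => i _;
   rewrite linearZ.
Qed.

Lemma projective_retract M N (h : {linear M -> N}) (r : {linear N -> M}) :
  cancel h r -> projective N -> projective M.
Proof.
move=> hK Nproj L L' g f gs; have [k kE] := Nproj _ _ g (f \o r) gs.
by exists (k \o h) => x; rewrite /= kE /= hK.
Qed.

Lemma surj_factor M N L (e : {linear M -> N}) (s : {linear M -> L}) :
  surjective_map e -> (forall x, e x = 0 -> s x = 0) ->
  exists t : {linear N -> L}, forall x, t (e x) = s x.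
Proof.
move=> /choice[i iK] es; pose t y := s (i y).
have tE x : t (e x) = s x.
  by apply/eqP; rewrite -subr_eq0 -linearB es // linearB iK subrr.
have t_lin : linear t.
  by move=> a u v; rewrite -{1}[u]iK -{1}[v]iK -linearP tE linearP.
pose t' : {linear N -> L} := HB.pack t (GRing.isLinear.Build A N L _ t t_lin).
by exists t'.
Qed.

End Modules.

(** * Koszul cochains *)

Section KoszulCochains.
Variables (A : comPzRingType) (n : nat) (x : 'I_n -> A).
Implicit Types (i k : 'I_n) (S T D : {set 'I_n}) (M N : lmodType A).

(* A cochain of degree [p] with values in [M] is a function on all subsets of
   which only the values on the subsets of cardinal [p] matter. *)
Definition ksign i S : A := (-1) ^+ #|[set j in S | (j < i)%N]|.

Definition kdiff M (c : {set 'I_n} -> M) S : M :=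
  \sum_(i in S) (ksign i S * x i) *: c (S :\ i).

(** Contraction with the basis vector of index [i]: the homotopy by which [x i] acts as zero on
    Koszul cohomology. *)
Definition khomotopy M i (c : {set 'I_n} -> M) S : M :=
  if i \in S then 0 else ksign i S *: c (i |: S).

Definition kface D p : pred {set 'I_n} := fun S => (S \subset D) && (#|S| == p).

(* Vanishing of the [p]-th cohomology for the subsequence of [x] indexed by [D];
   in degree 0 the right-hand side is [0], since [kdiff c' set0 = 0]. *)
Definition kvanish D M p := forall c : {set 'I_n} -> M,
  {in kface D p.+1, forall S, kdiff c S = 0} ->
  exists c', {in kface D p, c =1 kdiff c'}.

Lemma kface_D1 D p S i : S \in kface D p.+1 -> i \in S -> S :\ i \in kface D p.
Proof.
case/andP=> SD /eqP Sp iS; apply/andP; split.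
  exact: subset_trans (subsetDl S [set i]) SD.
by rewrite (cardsD1 i) iS in Sp; apply/eqP/succn_inj.
Qed.

Lemma kface_U1 D p S i :
  S \in kface D p -> i \in D -> i \notin S -> i |: S \in kface D p.+1.
Proof.
case/andP=> SD /eqP Sp iD iS; apply/andP; split; last by rewrite cardsU1 iS Sp.
by rewrite subUset sub1set iD.
Qed.

Lemma kface0 D S : S \in kface D 0 -> S = set0.
Proof. by case/andP=> _; rewrite cards_eq0 => /eqP. Qed.

Lemma ksign_sqr i S : ksign i S * ksign i S = 1.
Proof. by rewrite -expr2 sqrr_sign. Qed.

Lemma ksignD1 k i S : k \in S -> ksign i S = (-1) ^+ (k < i)%N * ksign i (S :\ k).
Proof.
move=> kS; rewrite /ksign (cardsD1 k) inE kS /= exprD; congr (_ * (-1) ^+ _).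
by apply: eq_card => j; rewrite !inE andbA.
Qed.

Lemma ksignU1 i S : ksign i (i |: S) = ksign i S.
Proof.
congr ((-1) ^+ _); apply: eq_card => j; rewrite !inE.
by case: eqP => [->|]; rewrite ?ltnn ?andbF.
Qed.

Lemma ksign_ltn i k : i != k -> (-1) ^+ (k < i)%N = - (-1) ^+ (i < k)%N :> A.
Proof.
by rewrite -val_eqE /=; case: ltngtP => //= _ _; rewrite expr1 expr0 ?opprK.
Qed.

(** This and the next two sign rules reduce to [ksignD1]; the minus sign arises because exactly one
    of [i < k] and [k < i] holds. *)
Lemma ksign_exchange i k S : k \in S -> i \notin S ->
  ksign k (i |: S) * ksign i (S :\ k) = - (ksign i S * ksign k S).
Proof.
move=> kS iS; have ik : i != k by apply: contraNneq iS => ->.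
rewrite (@ksignD1 i k) ?setU11 // setU1K // (@ksignD1 k i S) //.
by rewrite (ksign_ltn ik); ring.
Qed.

Lemma ksign_exchange2 i k S : k \in S -> i \notin S ->
  ksign k S * ksign i (S :\ k) = - (ksign i S * ksign k (i |: S)).
Proof.
move=> kS iS; have ik : i != k by apply: contraNneq iS => ->.
rewrite (@ksignD1 i k (i |: S)) ?setU11 // setU1K // (@ksignD1 k i S) //.
rewrite (ksign_ltn ik).
have bb : (-1) ^+ (i < k)%N * (-1) ^+ (i < k)%N = 1 :> A.
  by rewrite -expr2 sqrr_sign.
by ring: bb.
Qed.

Lemma ksign_anti i k S : i \in S -> k \in S -> i != k ->
  ksign i S * ksign k (S :\ i) = - (ksign k S * ksign i (S :\ k)).
Proof.
move=> iS kS ik; rewrite (@ksignD1 k i S) // (@ksignD1 i k S) //.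
by rewrite (ksign_ltn ik); ring.
Qed.

Lemma kdiff_ext M (c c' : {set 'I_n} -> M) S :
  (forall i, i \in S -> c (S :\ i) = c' (S :\ i)) -> kdiff c S = kdiff c' S.
Proof. by move=> cc'; apply: eq_bigr => i iS; rewrite cc'. Qed.

Lemma kdiff_lin M a (c c' : {set 'I_n} -> M) S :
  kdiff (fun T => a *: c T + c' T) S = a *: kdiff c S + kdiff c' S.
Proof.
rewrite scaler_sumr -big_split; apply: eq_bigr => i _ /=.
by rewrite scalerDr !scalerA mulrC.
Qed.

Lemma kdiff_map M N (h : {linear M -> N}) (c : {set 'I_n} -> M) S :
  h (kdiff c S) = kdiff (fun T => h (c T)) S.
Proof. by rewrite linear_sum; apply: eq_bigr => i _; rewrite linearZ. Qed.

Lemma kdiff_set0 M (c : {set 'I_n} -> M) : kdiff c set0 = 0.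
Proof. by rewrite /kdiff big_pred0 // => i; rewrite inE. Qed.

Lemma kdiffK M (c : {set 'I_n} -> M) S : kdiff (kdiff c) S = 0.
Proof.
rewrite /kdiff; under eq_bigr do rewrite scaler_sumr.
(* The ordered pairs of removed indices are split by which index is smaller; swapping the pairs of
   one half makes the two halves cancel termwise. *)
rewrite pair_big_dep /= (bigID (fun p : 'I_n * 'I_n => p.1 < p.2)%N) /=.
rewrite [X in _ + X](reindex_inj (h := fun p : 'I_n * 'I_n => (p.2, p.1))) /=; last first.
  by case=> [a b] [c' d] [-> ->].
rewrite (eq_bigl (fun p : 'I_n * 'I_n => [&& p.1 \in S, p.2 \in S & (p.1 < p.2)%N])); last first.
  move=> [i k] /=; rewrite !inE -val_eqE /=.
  by case: ltngtP; rewrite ?andbF ?andbT //.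
rewrite [X in _ + X](eq_bigl (fun p : 'I_n * 'I_n => [&& p.1 \in S, p.2 \in S & (p.1 < p.2)%N])).
  rewrite -big_split big1 // => -[i k] /= /and3P[iS kS ik].
  have ik' : i != k by rewrite -val_eqE neq_ltn ik.
  have -> : (S :\ k) :\ i = (S :\ i) :\ k.
    by apply/setP=> j; rewrite !inE andbCA.
  rewrite !scalerA -scalerDl.
  rewrite (_ : _ + _ = 0) ?scale0r //.
  by have e := ksign_anti iS kS ik'; ring: e.
move=> [i k] /=; rewrite !inE -val_eqE /= -leqNgt.
by case: ltngtP; rewrite ?andbF ?andbT // andbC.
Qed.

(** Terms removing an index other than [i] cancel by the exchange of signs; the term that removes
    [i] gives [x i *: c S]. *)
Lemma khomotopyE M i (c : {set 'I_n} -> M) S :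
  kdiff (khomotopy i c) S + khomotopy i (kdiff c) S = x i *: c S.
Proof.
rewrite {2}/khomotopy; case: ifPn => iS.
  rewrite addr0 /kdiff (bigD1 i) //= big1 ?addr0 => [|k /andP[kS ki]].
    rewrite /khomotopy !inE eqxx /= setD1K // scalerA.
    rewrite (@ksignD1 i i S) // ltnn expr0 mul1r mulrAC ksign_sqr mul1r //.
  by rewrite /khomotopy !inE eq_sym ki iS scaler0.
rewrite {2}/kdiff big_setU1 //= setU1K // scalerDr scalerA ksignU1.
rewrite mulrA ksign_sqr mul1r addrCA [X in _ + X](_ : _ = 0) ?addr0 //.
rewrite scaler_sumr -big_split big1 //= => k kS.
have ki : k != i by apply: contraNneq iS => <-.
rewrite /khomotopy !inE (negPf iS) andbF !scalerA.
rewrite (_ : (i |: S) :\ k = i |: (S :\ k)); last first.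
  by apply/setP=> j; rewrite !inE; case: (altP (j =P i)) => // ->; rewrite eq_sym ki.
rewrite -scalerDl (_ : _ + _ = 0) ?scale0r //.
by have e := ksign_exchange2 kS iS; ring: e.
Qed.

End KoszulCochains.

(** * Stability properties of Koszul vanishing *)

Section KoszulVanishing.
Variables (A : comPzRingType) (n : nat) (x : 'I_n -> A).
Implicit Types (i k : 'I_n) (S T D : {set 'I_n}) (M N : lmodType A).

(** Koszul cohomology is killed by the ideal of the sequence: the combination of the contractions
    with coefficients [a] is a primitive. *)
Lemma kcoboundary_ideal M D p (a : 'I_n -> A) (c : {set 'I_n} -> M) :
  {in kface D p.+1, forall S, kdiff x c S = 0} ->
  exists c', {in kface D p, forall S,
    (\sum_(i in D) a i * x i) *: c S = kdiff x c' S}.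
Proof.
move=> c0; exists (fun S => \sum_(i in D) a i *: khomotopy i c S) => S Sp.
rewrite scaler_suml /kdiff; under [RHS]eq_bigr do rewrite scaler_sumr.
rewrite exchange_big; apply: eq_bigr => i iD.
rewrite -scalerA -khomotopyE {2}/khomotopy.
rewrite [X in _ + X](_ : _ = 0) ?addr0; last first.
  by case: ifPn => // iS; rewrite c0 ?scaler0 //; apply: kface_U1.
rewrite scaler_sumr; apply: eq_bigr => k kS.
by rewrite !scalerA mulrC.
Qed.

(** A dual basis makes [M] a direct summand of a finite free module, so primitives can be found
    coordinate by coordinate. *)
Lemma kvanish_dual_basis M D p m (g : 'I_m -> M) (phi : 'I_m -> {linear M -> A^o}) :
  (forall v, v = \sum_j (phi j v : A) *: g j) ->
  kvanish x D A^o p -> kvanish x D M p.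
Proof.
move=> gE vA c c0.
have /choice[c' c'E] : forall j, exists c' : {set 'I_n} -> A^o,
    {in kface D p, forall S, phi j (c S) = kdiff x c' S}.
  by move=> j; apply: vA => S Sp; rewrite -kdiff_map c0 ?linear0.
exists (fun S => \sum_j (c' j S : A) *: g j) => S Sp.
rewrite [LHS]gE /kdiff; under [RHS]eq_bigr do rewrite scaler_sumr.
rewrite exchange_big; apply: eq_bigr => j _; rewrite c'E // scaler_suml.
by apply: eq_bigr => k _; rewrite scalerA.
Qed.

(** Exterior multiplication by the covector of index [i]; by [kdiff_extend] it anticommutes with the
    differential. *)
Definition kextend M i (c : {set 'I_n} -> M) S : M :=
  if i \in S then ksign A i S *: c (S :\ i) else 0.

Lemma kdiff_extend M i (c : {set 'I_n} -> M) S :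
  kdiff x (kextend i c) S =
    if i \in S then - (ksign A i S *: kdiff x c (S :\ i)) else 0.
Proof.
case: ifPn => iS; last first.
  rewrite /kdiff big1 // => k kS.
  by rewrite /kextend !inE (negPf iS) andbF scaler0.
rewrite /kdiff (bigD1 i) //= {1}/kextend !inE eqxx /= scaler0 add0r.
rewrite scaler_sumr -sumrN; apply: eq_big => [k|k /andP[kS ki]].
  by rewrite !inE andbC.
rewrite /kextend !inE eq_sym ki iS /= !scalerA -scaleNr.
have -> : (S :\ k) :\ i = (S :\ i) :\ k.
  by apply/setP=> j; rewrite !inE andbCA.
congr (_ *: _).
have := @ksign_exchange A _ i k (S :\ i); rewrite !inE kS ki eqxx setD1K //.
have -> : (S :\ i) :\ k = (S :\ k) :\ i.
  by apply/setP=> j; rewrite !inE andbCA.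
have is1 (U : {set 'I_n}) : ksign A i (U :\ i) = ksign A i U.
  by case: (boolP (i \in U)) => iU;
    [rewrite -{2}(setD1K iU) ksignU1 | congr ksign; apply/setDidPl;
     rewrite disjoint_sym disjoints1].
by rewrite !is1 => /(_ isT isT) e; ring: e.
Qed.

(** An explicit form of the exact sequence H^{p-1}(D) -> H^p(D + i) -> H^p(D). A cocycle is first
    made zero on the subsets of [D]; what remains is determined by its contraction with [i], a
    cocycle on [D] of degree one less. *)
Lemma kvanish_U1 M D g i :
  (forall p, (p < g)%N -> kvanish x D M p) ->
  forall p, (p < g)%N -> kvanish x (i |: D) M p.
Proof.
move=> vD p pk c c0; have [iD|iD] := boolP (i \in D).
  by move: c0; rewrite (setUidPr _) ?sub1set // => c0; apply: vD c c0.
have faceD q S : S \in kface D q -> S \in kface (i |: D) q.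
  case/andP=> SD Sq; apply/andP; split=> //.
  exact: fintype.subset_trans SD (finset.subsetUr _ _).
have [S Sp|c' c'E] := vD p pk c; first by apply/c0/faceD.
(* [c1] is cohomologous to [c] and vanishes on the subsets of [D]. *)
pose c1 S := c S - kdiff x (fun T => if i \in T then 0 else c' T) S.
have c10 S : S \in kface D p -> c1 S = 0.
  move=> Sp; rewrite /c1 c'E // [X in _ - X](@kdiff_ext _ _ _ _ _ c') ?subrr //.
  move=> j jS; rewrite !inE ifN // negb_and orbC; apply/orP; left.
  by apply: contra iD; case/andP: Sp => /subsetP/(_ i).
have c1Z S : S \in kface (i |: D) p.+1 -> kdiff x c1 S = 0.
  move=> Sp; rewrite (@kdiff_ext _ _ _ _ _ (fun T => (-1) *: kdiff x (fun T =>
    if i \in T then 0 else c' T) T + c T)); last first.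
    by move=> j _; rewrite scaleN1r addrC.
  by rewrite kdiff_lin kdiffK scaler0 add0r c0.
suff [c2 c2E] : exists c2, {in kface (i |: D) p, c1 =1 kdiff x c2}.
  exists (fun T => 1 *: c2 T + (if i \in T then 0 else c' T)) => S Sp.
  by rewrite kdiff_lin scale1r -c2E // subrK.
case: p => [|p] in pk c c0 c' c'E c1 c10 c1Z *.
  by exists c1 => S /kface0 ->; rewrite kdiff_set0 c10 //; apply/andP; split;
    rewrite ?sub0set ?cards0.
(* By [khomotopyE], the contraction of [c1] is a cocycle on [D], since both [c1] on [D] and
   [kdiff x c1] vanish. *)
have [S Sp|e eE] := vD p (ltnW pk) (khomotopy i c1).
  have iS : i \notin S by apply: contra iD; case/andP: Sp => /subsetP/(_ i).
  have := khomotopyE x i c1 S; rewrite c10 // scaler0 {2}/khomotopy (negPf iS).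
  rewrite c1Z ?scaler0 ?addr0 //; apply: kface_U1; rewrite ?setU11 //.
  exact: faceD.
exists (kextend i (fun T => - e T)) => S Sp; rewrite kdiff_extend.
case: ifPn => iS; last first.
  apply: c10; case/andP: Sp => SD Sp; apply/andP; split=> //.
  apply/subsetP => j jS; have /setU1P[ji|//] := subsetP SD j jS.
  by rewrite -ji jS in iS.
have Sip : S :\ i \in kface D p.
  have := kface_D1 Sp iS; case/andP=> SD Sp'; apply/andP; split=> //.
  apply/subsetP => j jS; have /setU1P[ji|//] := subsetP SD j jS.
  by rewrite ji !inE eqxx in jS.
rewrite (@kdiff_ext _ _ _ _ _ (fun T => (-1) *: e T + 0)); last first.
  by move=> j _; rewrite scaleN1r addr0.
rewrite kdiff_lin -eE // /khomotopy !inE eqxx /= setD1K //.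
rewrite [kdiff x _ _](_ : _ = 0) ?addr0; last first.
  by rewrite /kdiff big1 // => j _; rewrite scaler0.
rewrite scaleN1r scalerN opprK scalerA -{2}(setD1K iS) ksignU1 ksign_sqr.
by rewrite scale1r.
Qed.

Lemma kvanish_subset M D D' g : D \subset D' ->
  (forall p, (p < g)%N -> kvanish x D M p) ->
  forall p, (p < g)%N -> kvanish x D' M p.
Proof.
elim: {D'}#|D' :\: D| {-2}D' (erefl #|D' :\: D|) => [|m IHm] D' Dm sDD' vD.
  have : D' :\: D == set0 by rewrite -cards_eq0 Dm.
  rewrite setD_eq0 => sD'D; suff <- : D = D' by [].
  by apply/eqP; rewrite eqEsubset sDD'.
have /card_gt0P[i] : (0 < #|D' :\: D|)%N by rewrite Dm.
rewrite inE => /andP[iD iD'].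
rewrite -(setD1K iD'); apply: kvanish_U1; apply: IHm => //.
  apply: succn_inj; rewrite -Dm (cardsD1 i (D' :\: D)) !inE iD iD' add1n.
  by congr _.+1; apply: eq_card => j; rewrite !inE andbCA.
by rewrite subsetD1 sDD'.
Qed.

End KoszulVanishing.

(** Direct images along [g] identify the two complexes; [g] is increasing so that the signs, which
    count smaller indices, agree. *)
Lemma kvanish_imset (A : comPzRingType) n N (g : 'I_n -> 'I_N) (x : 'I_N -> A)
    (M : lmodType A) p :
  {mono g : i j / (i < j)%N} ->
  kvanish (x \o g) [set: 'I_n] M p -> kvanish x (g @: [set: 'I_n]) M p.
Proof.
move=> gm vM c c0.
have gI : injective g.
  move=> i j gij; apply/val_inj.
  by case: (ltngtP i j) => //; rewrite -gm gij ltnn.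
have dE (c' : {set 'I_N} -> M) (S : {set 'I_n}) :
    kdiff x c' (g @: S) = kdiff (x \o g) (fun T : {set 'I_n} => c' (g @: T)) S.
  rewrite /kdiff big_imset /=; last by move=> i j _ _; apply: gI.
  apply: eq_bigr => i iS; congr ((_ * _) *: c' _).
    congr (_ ^+ _); rewrite -(card_imset [set j in S | (j < i)%N] gI).
    apply: eq_card => j; rewrite !inE; apply/andP/imsetP => [[]|[l]].
      by case/imsetP=> l lS ->; rewrite gm => li; exists l; rewrite ?inE ?lS.
    by rewrite inE => /andP[lS li] ->; rewrite gm imset_f.
  apply/setP=> j; rewrite !inE; apply/andP/imsetP => [[ji]|[l]].
    case/imsetP=> l lS jE; exists l; rewrite // !inE lS andbT.
    by apply: contraNneq ji => <-; rewrite jE.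
  by rewrite !inE => /andP[li lS] ->; rewrite (inj_eq gI) li imset_f.
have faceE q (S : {set 'I_n}) :
    (S \in kface [set: 'I_n] q) = (g @: S \in kface (g @: [set: 'I_n]) q).
  by rewrite !unfold_in /kface subsetT imsetS ?subsetT // card_imset.
have [S Sp|c' c'E] := vM (fun T : {set 'I_n} => c (g @: T)).
  by rewrite -dE c0 // -faceE.
exists (fun T : {set 'I_N} => c' (g @^-1: T)) => T Tp.
have TE : T = g @: (g @^-1: T).
  apply/setP=> j; apply/idP/imsetP => [jT|[i]]; last by rewrite inE => ? ->.
  case/andP: (Tp) => /subsetP/(_ j jT)/imsetP[i _ ji] _.
  by exists i; rewrite // inE -ji.
rewrite TE dE c'E ?faceE -?TE //; apply: kdiff_ext => i _.
by congr c'; apply/setP=> j; rewrite [RHS]inE mem_imset.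
Qed.

(** * Comparison with the cohomology of the Koszul complex *)

Section KoszulCohomology.
Variables (A : comPzRingType) (n : nat) (x : 'I_n -> A) (N : lmodType A).
Implicit Types (c : {set 'I_n} -> N).

Definition kcochain c p : {linear koszul A n p -> N} :=
  free_comb (fun S : koszul_basis n p => c (val S)).

Definition kvalues p (phi : {linear koszul A n p -> N}) (T : {set 'I_n}) : N :=
  if insub T is Some s then phi (free_basis A (s : koszul_basis n p)) else 0.

Lemma kcochain_basis c p (S : koszul_basis n p) :
  kcochain c p (free_basis A S) = c (val S).
Proof. exact: free_comb_basis. Qed.

Lemma kvalues_cochain p (phi : {linear koszul A n p -> N}) u :
  phi u = kcochain (kvalues phi) p u.
Proof.
by rewrite free_combE; apply: eq_bigr => S _; rewrite /kvalues valK.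
Qed.

(** [kdiff] is the transpose of the Koszul differential: after exchanging sums, [S] and [i] in [S]
    leave only the term at [S] minus [i]. *)
Lemma kcochain_d c p u :
  kcochain c p (koszul_d x p u) = kcochain (kdiff x c) p.+1 u.
Proof.
rewrite /= /free_comb_fun.
under eq_bigr do rewrite ffunE scaler_suml.
rewrite exchange_big; apply: eq_bigr => S _ /=; rewrite /kdiff scaler_sumr.
under eq_bigr do rewrite scaler_suml.
under eq_bigr do rewrite big_mkcondr /=.
rewrite exchange_big; apply: eq_bigr => i iS.
have Tp : #|val S :\ i| == p.
  by have := valP S; rewrite (cardsD1 i) iS.
rewrite -big_mkcond (big_pred1 (Sub (val S :\ i) Tp : koszul_basis n p)) /=.
  by rewrite scalerA mulrC.
by move=> T; rewrite -val_eqE eq_sym.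
Qed.

Lemma kface_val p (S : koszul_basis n p) : val S \in kface [set: 'I_n] p.
Proof. by rewrite unfold_in /kface finset.subsetT (valP S). Qed.

Lemma kvanish_koszul p :
  kvanish x [set: 'I_n] N p <-> ~ koszul_cohomology_neq0 x N p.
Proof.
have ext c c' q u : {in kface [set: 'I_n] q, c =1 c'} ->
    kcochain c q u = kcochain c' q u.
  by move=> cc'; apply: eq_bigr => S _; rewrite cc' //; apply: kface_val.
have basisP q (S : {set 'I_n}) : S \in kface [set: 'I_n] q ->
    exists s : koszul_basis n q, S = val s.
  by case/andP=> _ Sq; exists (Sub S Sq : koszul_basis n q).
split=> [vN [phi [phiZ]]|nH c c0]; last first.
  have phiB : koszul_coboundary x (kcochain c p).
    apply: contra_notP nH => nB; exists (kcochain c p); split=> // u.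
    by rewrite kcochain_d (ext _ (fun _ => 0)) //; apply: big1 => S _;
       rewrite scaler0.
  case: p c0 phiB {nH} => [c0 phi0|q c0 [psi psiE]].
    exists c => S /[dup] Sp /basisP[s sE].
    by rewrite (kface0 Sp) kdiff_set0 -(kface0 Sp) sE -kcochain_basis phi0.
  exists (kvalues psi) => S /basisP[s ->].
  rewrite -kcochain_basis psiE kvalues_cochain kcochain_d.
  by rewrite kcochain_basis.
apply; have [S /basisP[s ->]|c' c'E] := vN (kvalues phi).
  by rewrite -kcochain_basis -kcochain_d -kvalues_cochain phiZ.
case: p phi phiZ c'E vN => [|q] phi phiZ c'E vN.
  move=> u; rewrite kvalues_cochain (ext _ _ _ _ c'E); apply: big1 => S _.
  by rewrite (kface0 (kface_val S)) kdiff_set0 scaler0.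
exists (kcochain c' q) => u.
by rewrite kcochain_d kvalues_cochain (ext _ _ _ _ c'E).
Qed.

Lemma Kgrade_seq_ge k :
  (ENat k <= Kgrade_seq x N)%O <->
  forall p, (p < k)%N -> kvanish x [set: 'I_n] N p.
Proof.
split=> [kx p pk|vN].
  apply/kvanish_koszul => Hp; suff : (k <= p)%N by rewrite leqNgt pk.
  suff : (ENat k <= ENat p)%O by [].
  by apply: le_trans kx (einf_lb _); exists p.
apply: einf_greatest => _ [p Hp <-]; rewrite /Order.le /= leqNgt.
by apply/negP => /vN/kvanish_koszul.
Qed.

End KoszulCohomology.

(** * Images and cokernels *)

Section ImageModule.
Local Open Scope quotient_scope.
Variables (S : comPzRingType) (M N : lmodType S) (h : {linear M -> N}).

Definition image_pred : {pred N} := fun y => `[< exists x, h x = y >].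

Fact image_submod_closed : subsemimod_closed image_pred.
Proof.
split; last by move=> a _ /asboolP[x <-]; apply/asboolP; exists (a *: x);
  rewrite linearZ.
split; first by apply/asboolP; exists 0; rewrite linear0.
move=> _ _ /asboolP[x <-] /asboolP[y <-]; apply/asboolP; exists (x + y).
by rewrite linearD.
Qed.

HB.instance Definition _ :=
  GRing.isSubmodClosed.Build S N image_pred image_submod_closed.

Definition image_module := {y : N | y \in image_pred}.

HB.instance Definition _ := SubChoice.on image_module.
HB.instance Definition _ := [SubChoice_isSubLmodule of image_module by <:].

Definition image_val : {linear image_module -> N} := val.

Lemma image_codom_subproof x : h x \in image_pred.
Proof. by apply/asboolP; exists x. Qed.

Definition image_codom (x : M) : image_module := Sub (h x) (image_codom_subproof x).

Fact image_codom_is_linear : linear image_codom.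
Proof. by move=> a u v; apply: val_inj; rewrite /= linearP. Qed.

HB.instance Definition _ :=
  GRing.isLinear.Build S M image_module _ image_codom image_codom_is_linear.

Lemma image_codom_surj : surjective_map image_codom.
Proof. by case=> y yP; have /asboolP[x xy] := yP; exists x; apply: val_inj. Qed.

Section Restrict.
Variables (P : lmodType S) (g : {linear P -> N}).
Hypothesis gh : forall x, exists y, h y = g x.

Fact image_restrict_subproof x : g x \in image_pred.
Proof. by apply/asboolP; apply: gh. Qed.

Definition image_restrict (x : P) : image_module :=
  Sub (g x) (image_restrict_subproof x).

Fact image_restrict_is_linear : linear image_restrict.
Proof. by move=> a u v; apply: val_inj; rewrite /= linearP. Qed.

HB.instance Definition _ :=
  GRing.isLinear.Build S P image_module _ image_restrict image_restrict_is_linear.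

(** [h] need not be surjective: both maps are restricted to the image of [h], onto which [h] is. *)
Lemma projective_lift : projective P -> exists k : {linear P -> M}, forall x, h (k x) = g x.
Proof.
move=> /(_ _ _ image_codom image_restrict image_codom_surj)[k kE].
by exists k => x; have /(congr1 val) := kE x.
Qed.

End Restrict.

Definition coker_rel : rel N := fun y z => `[< exists x, h x = y - z >].

Fact coker_rel_refl : reflexive coker_rel.
Proof. by move=> y; apply/asboolP; exists 0; rewrite linear0 subrr. Qed.

Fact coker_rel_sym : symmetric coker_rel.
Proof.
by move=> y z; apply/asboolP/asboolP => -[x xE]; exists (- x);
  rewrite linearN xE opprB.
Qed.

Fact coker_rel_trans : transitive coker_rel.
Proof.
move=> z y t /asboolP[x xE] /asboolP[x' x'E]; apply/asboolP; exists (x + x').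
by rewrite linearD xE x'E addrA subrK.
Qed.

Canonical coker_equiv :=
  EquivRel coker_rel coker_rel_refl coker_rel_sym coker_rel_trans.

Definition coker := {eq_quot coker_rel}.

HB.instance Definition _ := EqQuotient.on coker.
HB.instance Definition _ := Choice.on coker.

Definition coker_pi (y : N) : coker := \pi_coker y.

Lemma coker_piP y z : coker_pi y = coker_pi z <-> exists x, h x = y - z.
Proof.
by split=> [/eqmodP/asboolP|/asboolP yz]; last apply/eqmodP.
Qed.

Lemma coker_repr y : exists x, h x = repr (coker_pi y) - y.
Proof. by apply/coker_piP; rewrite /coker_pi reprK. Qed.

Lemma coker_piK u : coker_pi (repr u) = u. Proof. exact: reprK. Qed.

Definition coker_add (u v : coker) := coker_pi (repr u + repr v).
Definition coker_opp (u : coker) := coker_pi (- repr u).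
Definition coker_scale (a : S) (u : coker) := coker_pi (a *: repr u).

Lemma coker_addE y z : coker_add (coker_pi y) (coker_pi z) = coker_pi (y + z).
Proof.
apply/coker_piP; have [x xE] := coker_repr y; have [x' x'E] := coker_repr z.
by exists (x + x'); rewrite linearD xE x'E addrACA opprD.
Qed.

Lemma coker_oppE y : coker_opp (coker_pi y) = coker_pi (- y).
Proof.
apply/coker_piP; have [x xE] := coker_repr y.
by exists (- x); rewrite linearN xE opprD.
Qed.

Lemma coker_scaleE a y : coker_scale a (coker_pi y) = coker_pi (a *: y).
Proof.
apply/coker_piP; have [x xE] := coker_repr y.
by exists (a *: x); rewrite linearZ /= xE scalerBr.
Qed.

Fact coker_addA : associative coker_add.
Proof.
move=> u v w; rewrite -[u]coker_piK -[v]coker_piK -[w]coker_piK.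
by rewrite !coker_addE addrA.
Qed.

Fact coker_addC : commutative coker_add.
Proof.
by move=> u v; rewrite -[u]coker_piK -[v]coker_piK !coker_addE addrC.
Qed.

Fact coker_add0 : left_id (coker_pi 0) coker_add.
Proof. by move=> u; rewrite -[u]coker_piK coker_addE add0r. Qed.

Fact coker_addN : left_inverse (coker_pi 0) coker_opp coker_add.
Proof. by move=> u; rewrite -[u]coker_piK coker_oppE coker_addE addNr. Qed.

HB.instance Definition _ := GRing.isZmodule.Build coker
  coker_addA coker_addC coker_add0 coker_addN.

Fact coker_scaleA a b u : coker_scale a (coker_scale b u) = coker_scale (a * b) u.
Proof. by rewrite -[u]coker_piK !coker_scaleE scalerA. Qed.
Fact coker_scale1 : left_id 1 coker_scale.
Proof. by move=> u; rewrite -[u]coker_piK coker_scaleE scale1r. Qed.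
Fact coker_scaleDr : right_distributive coker_scale +%R.
Proof.
move=> a u v; rewrite -[u]coker_piK -[v]coker_piK [_ + _]coker_addE.
by rewrite !coker_scaleE [RHS]coker_addE scalerDr.
Qed.
Fact coker_scaleDl u : {morph coker_scale^~ u : a b / a + b}.
Proof.
move=> a b; rewrite -[u]coker_piK.
by rewrite !coker_scaleE [RHS]coker_addE scalerDl.
Qed.

HB.instance Definition _ := GRing.Zmodule_isLmodule.Build S coker
  coker_scaleA coker_scale1 coker_scaleDr coker_scaleDl.

Fact coker_pi_is_linear : linear coker_pi.
Proof. by move=> a u v; rewrite -coker_addE -coker_scaleE. Qed.

HB.instance Definition _ :=
  GRing.isLinear.Build S N coker _ coker_pi coker_pi_is_linear.

Lemma coker_exact : exact_at h coker_pi.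
Proof.
move=> y; split=> [y0|[x <-]].
  by have /coker_piP[x xE] : coker_pi y = coker_pi 0 by []; exists x;
    rewrite xE subr0.
by rewrite -[RHS](linear0 coker_pi); apply/coker_piP; exists x; rewrite subr0.
Qed.

Lemma coker_surj : surjective_map coker_pi.
Proof. by move=> u; exists (repr u); apply: coker_piK. Qed.

End ImageModule.

(** * Projective resolutions *)

Section Resolutions.
Variable S : comPzRingType.
Implicit Types (M N K L : lmodType S) (k : nat).

Lemma has_resolution0 (C : lmodType S -> Prop) N : C N -> has_resolution C N 0.
Proof.
move=> CN; pose P i : lmodType S := if i is 0 then N else {ffun 'I_0 -> S^o}.
exists P, (fun i => \0 : {linear P i.+1 -> P i}), idfun; split=> //.
- by case.
- by case=> // i _ x; apply/ffunP; case.
- by move=> y; exists y.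
- move=> y; split=> [y0|[x <-] //].
  by exists 0; apply: esym.
- by move=> i y; split=> // _; exists 0; rewrite linear0; apply/ffunP; case.
Qed.

Lemma has_resolutionS (C : lmodType S -> Prop) N (P0 : lmodType S) K k (e : {linear P0 -> N})
    (i : {linear K -> P0}) :
  C P0 -> surjective_map e -> injective i -> exact_at i e ->
  has_resolution C K k -> has_resolution C N k.+1.
Proof.
move=> CP0 es i_inj ie [P [d [eK [CP P0' eKs dE dS]]]].
pose P' j : lmodType S := if j is j'.+1 then P j' else P0.
pose d' j : {linear P' j.+1 -> P' j} :=
  if j is j'.+1 return {linear P' j.+1 -> P' j} then d j' else (i \o eK).
exists P', d', e; split=> //.
- by case=> // j jk; apply: CP.
- by case=> // j jk; apply: P0'.
- move=> y; split=> [/ie[x <-]|[x <-]]; last by apply/ie; exists (eK x).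
  by have [z <-] := eKs x; exists z.
case=> [|j] //= y; split=> [iy|[x <-]] /=.
  by apply/dE; apply: i_inj; rewrite linear0; apply: iy.
by rewrite (_ : eK _ = 0) ?linear0 //; apply/dE; exists x.
Qed.

(** Induction replaces [N] by its first syzygy, the image of [d 0], until the split map is [d 0]
    itself; then [N] is a direct summand of [P 0]. *)
Lemma resolution_shorten N k (P : nat -> lmodType S)
    (d : forall i, {linear P i.+1 -> P i}) (e : {linear P 0 -> N}) :
  (forall i, (i <= k.+1)%N -> fg_projective (P i)) ->
  surjective_map e -> exact_at (d 0) e ->
  (forall i, exact_at (d i.+1) (d i)) ->
  (exists r : {linear P k -> P k.+1}, cancel (d k) r) ->
  has_resolution (@fg_projective S) N k.
Proof.
elim: k N P d e => [|k IHk] N P d e CP es dE dS [r rK].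
  (* The projector [1 - d r] kills the image of [d 0], so it descends to a section of [e]. *)
  have [|s sE] := surj_factor es (s := idfun \- (d 0 \o r)).
    by move=> x /dE[y <-] /=; rewrite rK subrr.
  have [P0fg P0proj] := CP 0 isT.
  apply: has_resolution0; split; first exact: fg_surj es P0fg.
  apply: (projective_retract (h := s) (r := e)) P0proj => y.
  have [x <-] := es y; rewrite sE /= linearB [e (d _ _)](_ : _ = 0) ?subr0 //.
  by apply/dE; exists (r x).
apply: (has_resolutionS (i := image_val (d 0)) _ es) => //; first exact: CP.
- exact: val_inj.
- move=> y; split=> [/dE[x <-]|[x <-]]; first by exists (image_codom (d 0) x).
  by apply/dE; have /asboolP := valP x.
apply: (IHk _ (fun i => P i.+1) (fun i => d i.+1) (image_codom (d 0))) => //.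
- by move=> i ik; apply: CP.
- exact: image_codom_surj.
- move=> y; rewrite -dS; split=> [/(congr1 val) //|dy]; exact: val_inj.
by exists r.
Qed.

(** Used to build chain maps and homotopies degree by degree: [R] is the equation linking
    consecutive terms, [G] the invariant that makes the next lift possible. *)
Lemma dependent_choice (X : nat -> Type) (G : forall i, X i -> Prop)
    (R : forall i, X i -> X i.+1 -> Prop) (x0 : X 0) :
  G 0 x0 -> (forall i x, G i x -> exists y, R i x y /\ G i.+1 y) ->
  exists s : forall i, X i, s 0 = x0 /\ forall i, R i (s i) (s i.+1).
Proof.
move=> G0 GS.
have step i (x : {x | G i x}) : {y : {y | G i.+1 y} | R i (sval x) (sval y)}.
  by case: x => x Gx; have /cid[y [Rxy Gy]] := GS i x Gx; exists (exist _ y Gy).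
pose fix s i : {x | G i x} :=
  if i is j.+1 then sval (step j (s j)) else exist _ x0 G0.
by exists (fun i => sval (s i)); split=> // i; apply: svalP (step i (s i)).
Qed.

Lemma comparison_map (X Y : nat -> lmodType S)
    (dX : forall i, {linear X i.+1 -> X i}) (dY : forall i, {linear Y i.+1 -> Y i})
    (f0 : {linear X 0 -> Y 0}) :
  (forall i, projective (X i.+1)) -> (forall i x, dX i (dX i.+1 x) = 0) ->
  surjective_map (dY 0) -> (forall i, exact_at (dY i.+1) (dY i)) ->
  exists f : forall i, {linear X i -> Y i}, f 0 = f0 /\
    forall i x, dY i (f i.+1 x) = f i (dX i x).
Proof.
move=> Xproj dX0 dYs dYE.
pose G i : {linear X i -> Y i} -> Prop :=
  if i is j.+1 then fun f => forall x, dY j (f (dX j.+1 x)) = 0 else fun=> True.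
apply: (@dependent_choice _ G
  (fun i f f' => forall x, dY i (f' x) = f (dX i x))) => // i f Gf.
have [|f' f'E] := projective_lift (h := dY i) (g := f \o dX i) _ (Xproj i).
  move=> x /=; case: i f Gf x => [|i] f Gf x; first exact: dYs.
  exact/dYE/Gf.
by exists f'; split=> // x; rewrite f'E /= dX0 linear0.
Qed.

(** At each stage [t - h d] has values in the kernel of the differential, which by exactness is the
    image of the next one, so projectivity lifts it. *)
Lemma null_homotopy (X : nat -> lmodType S)
    (dX : forall i, {linear X i.+1 -> X i}) (t : forall i, {linear X i -> X i}) :
  (forall i, projective (X i.+1)) -> (forall i, exact_at (dX i.+1) (dX i)) ->
  (forall i x, dX i (t i.+1 x) = t i (dX i x)) -> (forall x, t 0 x = 0) ->
  exists h : forall i, {linear X i -> X i.+1},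
    forall i x, t i.+1 x = dX i.+1 (h i.+1 x) + h i (dX i x).
Proof.
move=> Xproj dXE tE t0.
have dX0 i x : dX i (dX i.+1 x) = 0 by apply/dXE; exists x.
pose G i (h : {linear X i -> X i.+1}) :=
  forall x, dX i (t i.+1 x - h (dX i x)) = 0.
have [|i h Gh|h [_ hE]] := @dependent_choice _ G (fun i h h' =>
  forall x, t i.+1 x = dX i.+1 (h' x) + h (dX i x)) \0.
- by move=> x; rewrite subr0 tE t0.
- have [x|h' h'E] := projective_lift (h := dX i.+1)
    (g := t i.+1 \- (h \o dX i)) _ (Xproj i).
    by have /dXE[y yE] := Gh x; exists y.
  exists h'; split=> x; rewrite ?h'E /= ?subrK // linearB h'E /= dX0 linear0.
  by rewrite subr0 tE subrr.
by exists h.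
Qed.

(* The identity of [P] is homotopic to a chain map factoring through a
   resolution of length at most [k], which vanishes in degree [k.+1]. *)
Lemma resolution_split N k m (P : nat -> lmodType S)
    (d : forall i, {linear P i.+1 -> P i}) (e : {linear P 0 -> N}) :
  (forall i, projective (P i)) -> (forall x : P k.+2, x = 0) ->
  surjective_map e -> exact_at (d 0) e ->
  (forall i, exact_at (d i.+1) (d i)) ->
  has_resolution (@projective S) N m -> (m <= k)%N ->
  exists r : {linear P k -> P k.+1}, cancel (d k) r.
Proof.
move=> Pproj P0 es dE dS [Q [d' [e' [Qproj Q0 e's d'E d'S]]]] mk.
(* The augmented complexes carry [N] in index 0, so [P j] sits in index [j.+1]. *)
pose X i : lmodType S := if i is j.+1 then P j else N.
pose Y i : lmodType S := if i is j.+1 then Q j else N.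
pose dX i : {linear X i.+1 -> X i} :=
  if i is j.+1 return {linear X i.+1 -> X i} then d j else e.
pose dY i : {linear Y i.+1 -> Y i} :=
  if i is j.+1 return {linear Y i.+1 -> Y i} then d' j else e'.
have dXE i : exact_at (dX i.+1) (dX i) by case: i.
have dYE i : exact_at (dY i.+1) (dY i) by case: i.
have Xproj i : projective (X i.+1) by exact: Pproj.
have Yproj i : projective (Y i.+1).
  case: (leqP i m) => im; first exact: Qproj.
  move=> M L g h gs; exists \0 => x.
  by rewrite (Q0 _ im x) !linear0.
have [i x|f [f0 fE]] := @comparison_map X Y dX dY idfun Xproj _ e's dYE.
  by apply/dXE; exists x.
have [i x|g [g0 gE]] := @comparison_map Y X dY dX idfun Yproj _ es dXE.
  by apply/dYE; exists x.
have [i x|x|h hE] := @null_homotopy X dX (fun i => idfun \- (g i \o f i)) Xproj dXE.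
- by rewrite /= linearB gE fE.
- by rewrite /= f0 g0 subrr.
(* On [P k.+1] the chain map factors through [Q k.+1 = 0], and the outer homotopy term has values in
   [P k.+2 = 0]; only [h d] is left to equal the identity. *)
exists (h k.+1) => x; have := hE k.+1 x; rewrite /=.
have -> : f k.+2 x = 0 by apply: (Q0 k.+1).
have -> : h k.+2 x = 0 by apply: P0.
by rewrite !linear0 addr0 add0r => <-.
Qed.

End Resolutions.

(** * Grade bounds the finitistic dimension from below *)

Section TruncatedKoszul.
Variables (A : comPzRingType) (n : nat) (x : 'I_n -> A) (k : nat).

(* The first [k] steps of the Koszul cochain complex of [A], indexed downwards
   so as to form a free resolution: [tkoszul i] consists of the cochains of
   degree [k - i], and is zero for [k < i]. *)
Definition tkoszul_basis i := {S : {set 'I_n} | (#|S| + i == k)%N}.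
Definition tkoszul i : lmodType A := {ffun tkoszul_basis i -> A^o}.

Definition tkoszul_ext i (c : tkoszul i) (S : {set 'I_n}) : A^o :=
  if insub S is Some s then c s else 0.

Definition tkoszul_res i (c : {set 'I_n} -> A^o) : tkoszul i :=
  [ffun s => c (val s)].

Definition tkoszul_d_fun i (c : tkoszul i.+1) : tkoszul i :=
  tkoszul_res i (kdiff x (tkoszul_ext c)).

Fact tkoszul_d_is_linear i : linear (@tkoszul_d_fun i).
Proof.
move=> a u v; apply/ffunP=> s; rewrite !ffunE -kdiff_lin.
apply: kdiff_ext => j _; rewrite /tkoszul_ext.
by case: insub => [t|]; rewrite ?ffunE // scaler0 addr0.
Qed.

HB.instance Definition _ i := GRing.isLinear.Build A (tkoszul i.+1) (tkoszul i) _
  (@tkoszul_d_fun i) (@tkoszul_d_is_linear i).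

Definition tkoszul_d i : {linear tkoszul i.+1 -> tkoszul i} := @tkoszul_d_fun i.

Lemma tkoszul_extE i (c : tkoszul i) : tkoszul_res i (tkoszul_ext c) = c.
Proof. by apply/ffunP=> s; rewrite ffunE /tkoszul_ext valK. Qed.

Lemma tkoszul_d_res i c :
  tkoszul_d i (tkoszul_res i.+1 c) = tkoszul_res i (kdiff x c).
Proof.
apply/ffunP=> s; rewrite !ffunE; apply: kdiff_ext => j js.
rewrite /tkoszul_ext; case: insubP => [t _ tE|/negP[]]; first by rewrite ffunE tE.
by have := valP s; rewrite (cardsD1 j (val s)) js add1n addSn addnS.
Qed.

Lemma tkoszul_eq0 i (c : tkoszul i) : (k < i)%N -> c = 0.
Proof.
move=> ki; apply/ffunP=> -[S Sk]; exfalso; move: ki.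
by rewrite -(eqP Sk) ltnNge leq_addl.
Qed.

Hypothesis xk : forall p, (p < k)%N -> kvanish x [set: 'I_n] A^o p.

Lemma tkoszul_exact i : exact_at (tkoszul_d i.+1) (tkoszul_d i).
Proof.
move=> y; split=> [y0|[z <-]]; last first.
  rewrite -(tkoszul_extE z) !tkoszul_d_res.
  by apply/ffunP=> s; rewrite !ffunE kdiffK.
have [ik|ki] := ltnP i k; last by exists 0; rewrite linear0 [RHS]tkoszul_eq0.
(* Homological index [i.+1] is cochain degree [k - i.+1], which lies below [k]. *)
have [|S Sp|c cE] := xk (p := (k - i.+1)%N) _ (c := tkoszul_ext y).
- by rewrite ltn_subrL (leq_ltn_trans _ ik).
- have Si : (#|S| + i == k)%N.
    by case/andP: Sp => _ /eqP->; rewrite addSnnS subnK.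
  by have /ffunP/(_ (Sub S Si)) := y0; rewrite !ffunE.
exists (tkoszul_res i.+2 c); rewrite tkoszul_d_res -[RHS]tkoszul_extE.
apply/ffunP=> s; rewrite !ffunE cE // unfold_in /kface finset.subsetT /=.
by rewrite -(eqn_add2r i.+1) (eqP (valP s)) subnK.
Qed.

End TruncatedKoszul.

Lemma fPD_ge (A : comPzRingType) n (x : 'I_n -> A) k :
  ~ (exists c : 'I_n -> A, 1 = \sum_i c i * x i) ->
  (forall p, (p < k)%N -> kvanish x [set: 'I_n] A^o p) ->
  (ENat k <= fPD A)%O.
Proof.
case: k => [|k] x1 xk; first by case: (fPD A).
pose P := tkoszul A n k.+1; pose d i := tkoszul_d x k.+1 i.
pose N : lmodType A := coker (d 0).
pose e : {linear P 0 -> N} := coker_pi (d 0).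
have es : surjective_map e by apply: coker_surj.
have dE : exact_at (d 0) e by apply: coker_exact.
have dS i : exact_at (d i.+1) (d i) by apply: tkoszul_exact.
have Pproj i : projective (P i) by apply: free_projective.
apply: (@le_trans _ _ (projdim N)); last first.
  apply: esup_ub; exists N; split=> //; exists k.+1, P, d, e; split=> //.
    by move=> i _; split; [apply: free_fg | apply: Pproj].
  by move=> i ki y; apply: tkoszul_eq0.
apply: einf_greatest => _ [m Nm <-]; rewrite /Order.le /= ltnNge.
(* A shorter resolution would give a retraction [r] of the first Koszul map, from cochains of degree
   0 to cochains of degree 1. *)
apply/negP => mk; have [|r rK] := resolution_split Pproj _ es dE dS Nm mk.
  by move=> y; apply: tkoszul_eq0.
have s0P : (#|@set0 'I_n| + k.+1 == k.+1)%N by rewrite cards0.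
pose s0 : tkoszul_basis n k.+1 k.+1 := Sub set0 s0P.
have := rK (tkoszul_res k.+1 k.+1 (fun=> 1)).
rewrite /d tkoszul_d_res => /ffunP/(_ s0); rewrite [RHS]ffunE free_combE.
rewrite sum_ffunE => one; apply: x1.
(* The sets [s] here are singletons, so the coefficient of [x i] is essentially the value of [r] on
   the basis cochain at [i]. Evaluating [r d = 1] on the cochain 1 gives the relation. *)
exists (fun i => \sum_(s : tkoszul_basis n k.+1 k | i \in val s)
  r (free_basis A s) s0 * ksign A i (val s)).
rewrite -one; under eq_bigr do rewrite !ffunE scaler_suml.
rewrite (exchange_big_dep xpredT) //=; apply: eq_bigr => i _.
rewrite mulr_suml; apply: eq_bigr => s _.
by rewrite /GRing.scale /=; ring.
Qed.

(** * Minimality modulo a maximal ideal *)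

Section MaximalIdeals.
Variable A : comPzRingType.
Implicit Types (I m : ideal A).

Lemma idealB I a b : ideal_set I a -> ideal_set I b -> ideal_set I (a - b).
Proof.
by move=> Ia Ib; rewrite -mulN1r; apply: ideal_D => //; apply: ideal_M.
Qed.

Lemma ideal_sum I (T : Type) (r : seq T) (p : pred T) (F : T -> A) :
  (forall i, p i -> ideal_set I (F i)) -> ideal_set I (\sum_(i <- r | p i) F i).
Proof.
move=> IF; elim/big_rec: _ => [|i a pi Ia]; first exact: ideal_0.
by apply: ideal_D => //; apply: IF.
Qed.

Section Span.
Variables (n : nat) (x : 'I_n -> A).

Definition span_set : set A := fun a => exists c : 'I_n -> A, a = \sum_i c i * x i.

Fact span_set0 : span_set 0.
Proof. by exists (fun=> 0); rewrite big1 // => i _; rewrite mul0r. Qed.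

Fact span_setD a b : span_set a -> span_set b -> span_set (a + b).
Proof.
move=> [c ->] [c' ->]; exists (fun i => c i + c' i).
by rewrite -big_split; apply: eq_bigr => i _; rewrite mulrDl.
Qed.

Fact span_setM a b : span_set b -> span_set (a * b).
Proof.
move=> [c ->]; exists (fun i => a * c i).
by rewrite mulr_sumr; apply: eq_bigr => i _; rewrite mulrA.
Qed.

Definition span_ideal : ideal A := Ideal span_set0 span_setD span_setM.

Lemma span_ideal_gen j : ideal_set span_ideal (x j).
Proof.
exists (fun i => (i == j)%:R).
by rewrite (bigD1 j) //= eqxx mul1r big1 ?addr0 // => i /negPf->; rewrite mul0r.
Qed.

Lemma span_ideal_sub I :
  (forall j, ideal_set I (x j)) -> (span_ideal `<=` I)%classic.
Proof. by move=> Ix _ [c ->]; apply: ideal_sum => i _; apply: ideal_M. Qed.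

End Span.

Lemma maximal_ideal_above I : ~ ideal_set I 1 ->
  exists m, maximal_ideal m /\ (I `<=` m)%classic.
Proof.
move=> I1.
(* Zorn's lemma is applied to the sets whose union with [I] is a proper ideal, so that the empty
   chain is bounded by [I]. *)
pose proper (X : set A) := exists J : ideal A, ideal_set J = X /\ ~ ideal_set J 1.
have [F FP Ftot|X [[m [mE m1]] Xmax]] :=
    @Zorn_bigcup _ [set X | proper (I `|` X)%classic].
  have FU a b : (I `|` \bigcup_(X in F) X)%classic a ->
      (I `|` \bigcup_(X in F) X)%classic b ->
      exists J : ideal A, [/\ ideal_set J a, ideal_set J b &
        (J `<=` I `|` \bigcup_(X in F) X)%classic].
    have sub X (J : ideal A) : F X -> ideal_set J = (I `|` X)%classic ->
        (J `<=` I `|` \bigcup_(X in F) X)%classic.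
      by move=> FX -> c [Ic|Xc]; [left | right; exists X].
    move=> [Ia|[X FX Xa]] [Ib|[Y FY Yb]].
    - by exists I; split=> // c Ic; left.
    - have [J [JE _]] := FP Y FY; exists J; split; last exact: sub JE.
        by rewrite JE; left.
      by rewrite JE; right.
    - have [J [JE _]] := FP X FX; exists J; split; last exact: sub JE.
        by rewrite JE; right.
      by rewrite JE; left.
    have [XY|YX] := Ftot X Y FX FY.
      have [J [JE _]] := FP Y FY; exists J; split; last exact: sub JE.
        by rewrite JE; right; apply: XY.
      by rewrite JE; right.
    have [J [JE _]] := FP X FX; exists J; split; last exact: sub JE.
      by rewrite JE; right.
    by rewrite JE; right; apply: YX.
  have U0 : (I `|` \bigcup_(X in F) X)%classic 0 by left; apply: ideal_0.
  have UD a b : (I `|` \bigcup_(X in F) X)%classic a ->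
      (I `|` \bigcup_(X in F) X)%classic b ->
      (I `|` \bigcup_(X in F) X)%classic (a + b).
    by move=> /FU /[apply] -[J [Ja Jb]]; apply; apply: ideal_D.
  have UM c a : (I `|` \bigcup_(X in F) X)%classic a ->
      (I `|` \bigcup_(X in F) X)%classic (c * a).
    by move=> /[dup] /FU /[apply] -[J [Ja _]]; apply; apply: ideal_M.
  exists (Ideal U0 UD UM); split=> // -[//|[X FX X1]].
  by have [J [JE]] := FP X FX; apply; rewrite JE; right.
exists m; split; last by rewrite mE => a Ia; left.
split=> // J mJ J1 a Ja; rewrite mE; right; apply: contrapT => Xa.
apply: (Xmax J).
  split; last by move=> /(_ a Ja).
  by move=> b Xb; apply: mJ; rewrite mE; right.
exists J; split=> //; apply/seteqP; split=> [b Jb|b [Ib|//]]; first by right.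
by apply: mJ; rewrite mE; left.
Qed.

Lemma maximal_ideal_inv m a : maximal_ideal m -> ~ ideal_set m a ->
  exists t, ideal_set m (1 - t * a).
Proof.
case=> m1 mmax ma; apply: contrapT => nt.
(* This is the ideal [m + (a)]; if it were proper, maximality would put [a] in [m]. *)
pose Ia (b : A) := exists c, ideal_set m (b - c * a).
have Ia0 : Ia 0 by exists 0; rewrite mul0r subr0; apply: ideal_0.
have IaD b b' : Ia b -> Ia b' -> Ia (b + b').
  move=> [c mc] [c' mc']; exists (c + c').
  by rewrite mulrDl opprD addrACA; apply: ideal_D.
have IaM c b : Ia b -> Ia (c * b).
  move=> [t mt]; exists (c * t).
  by rewrite -mulrA -mulrBr; apply: ideal_M.
have := mmax (Ideal Ia0 IaD IaM) _ nt a; apply: (fun H => ma (H _ _)).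
  by move=> b mb; exists 0; rewrite mul0r subr0.
by exists 1; rewrite mul1r subrr; apply: ideal_0.
Qed.

(* Modulo a maximal ideal the functionals are vectors over a field, and this
   is the statement that a functional vanishing on the common kernel of
   finitely many others is a linear combination of them. *)
Lemma functional_span m (P : lmodType A) (psi : nat -> {linear P -> A^o}) b
    (phi : {linear P -> A^o}) : maximal_ideal m ->
  (forall v, (forall j, (j < b)%N -> ideal_set m (psi j v)) ->
     ideal_set m (phi v)) ->
  exists c : nat -> A,
    forall v, ideal_set m ((phi v : A) - \sum_(j < b) c j * psi j v).
Proof.
move=> mmax; elim: b phi => [|b IHb] phi phiP.
  by exists (fun=> 0) => v; rewrite big_ord0 subr0; apply: phiP.
have [phib|/existsNP[w /not_implyP[psiw phiw]]] := pselect (forall v,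
    (forall j, (j < b)%N -> ideal_set m (psi j v)) -> ideal_set m (phi v)).
  have [c cP] := IHb phi phib.
  exists (fun j => if (j < b)%N then c j else 0) => v.
  rewrite big_ord_recr /= ltnn mul0r addr0.
  by under eq_bigr do rewrite ltn_ord; apply: cP.
have psibw : ~ ideal_set m (psi b w).
  move=> mw; apply: phiw; apply: phiP => j; rewrite ltnS leq_eqVlt.
  by case/orP=> [/eqP->|/psiw].
have [t tP] := maximal_ideal_inv mmax psibw.
(* With [t] inverse to [psi b w] modulo [m], subtracting [s * psi b] makes [phi] vanish at [w]
   modulo [m]. *)
pose s : A := t * phi w.
have phi'_lin : linear (fun v => (phi v : A) - s * psi b v : A^o).
  move=> a u v; rewrite !linearP /= /GRing.scale /=; ring.
pose phi' : {linear P -> A^o} :=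
  HB.pack (fun v => (phi v : A) - s * psi b v : A^o)
    (GRing.isLinear.Build A P A^o _ _ phi'_lin).
have [v psiv|c cP] := IHb phi'.
  (* Projection of [v] along [w] to the kernel of [psi b] modulo [m]. *)
  pose u := v - (t * psi b v : A) *: w.
  have mu : ideal_set m (phi u).
    apply: phiP => j; rewrite ltnS leq_eqVlt => /orP[/eqP->|jb].
      rewrite linearB linearZ /= /GRing.scale /=.
      rewrite (_ : _ - _ = psi b v * (1 - t * psi b w)); last by ring.
      exact: ideal_M.
    rewrite linearB linearZ /=; apply: idealB; first exact: psiv.
    by apply: ideal_M; apply: psiw.
  rewrite (_ : phi' v = phi u) //= /u linearB linearZ /= /GRing.scale /= /s.
  by ring.
exists (fun j => if (j < b)%N then c j else s) => v.
rewrite big_ord_recr /= ltnn; under eq_bigr do rewrite ltn_ord.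
have := cP v; rewrite /= (_ : (_ - s * _) - _ = phi v - (
  \sum_(i < b) c i * psi i v + s * psi b v)) //; by ring.
Qed.

Lemma ideal_det I n (M M' : 'M[A]_n) :
  (forall i j, ideal_set I (M i j - M' i j)) -> ideal_set I (\det M - \det M').
Proof.
move=> MM'; rewrite /determinant -sumrB; apply: ideal_sum => s _.
rewrite -mulrBr; apply: ideal_M.
apply: (big_ind2 (fun a b => ideal_set I (a - b))) => // [|a b a' b' Ia Ib].
  by rewrite subrr; apply: ideal_0.
rewrite (_ : _ - _ = a' * (a - b) + b * (a' - b')); last by ring.
by apply: ideal_D; apply: ideal_M.
Qed.

End MaximalIdeals.

Section Minimality.
Variable A : comPzRingType.
Implicit Types (P Q : lmodType A).

Definition dual_comb_fun P Q n (psi : 'I_n -> {linear Q -> A^o}) (g : 'I_n -> P) w :=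
  \sum_i (psi i w : A) *: g i.

Fact dual_comb_is_linear P Q n (psi : 'I_n -> {linear Q -> A^o}) (g : 'I_n -> P) :
  linear (dual_comb_fun psi g).
Proof.
move=> a u v; rewrite /dual_comb_fun scaler_sumr -big_split.
by apply: eq_bigr => i _; rewrite linearP scalerDl scalerA.
Qed.

HB.instance Definition _ P Q n (psi : 'I_n -> {linear Q -> A^o}) (g : 'I_n -> P) :=
  GRing.isLinear.Build A Q P _ (dual_comb_fun psi g) (dual_comb_is_linear psi g).

(** The scalars [a] for which [a] times the identity of [P] factors through [d] form a proper ideal;
    take [m] above it. If [d] were injective modulo [m], some [h] would satisfy [h d = 1] modulo
    [m], and Cramer's rule would put into that ideal a determinant congruent to 1. *)
Lemma nonsplit_minimal P Q (d : {linear P -> Q}) :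
  fg_projective P -> fg_projective Q ->
  ~ (exists r : {linear Q -> P}, cancel d r) ->
  exists m : ideal A, maximal_ideal m /\
  exists n (q : 'I_n -> Q) (psi : 'I_n -> {linear Q -> A^o}) v
    (lam : {linear P -> A^o}),
  [/\ forall w, w = \sum_j (psi j w : A) *: q j,
      forall j, ideal_set m (psi j (d v)) & ideal_set m (1 - lam v)].
Proof.
move=> /dual_basis[p [g [phi gE]]] /dual_basis[n [q [psi qE]]] nsplit.
pose split_scalar (a : A) := exists h : {linear Q -> P}, forall v, h (d v) = a *: v.
have s0 : split_scalar 0 by exists \0 => v; rewrite scale0r.
have sD a b : split_scalar a -> split_scalar b -> split_scalar (a + b).
  by move=> [h hE] [h' h'E]; exists (h \+ h') => v; rewrite /= hE h'E scalerDl.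
have sM a b : split_scalar b -> split_scalar (a * b).
  by move=> [h hE]; exists (a \*: h) => v; rewrite /= hE scalerA.
have [|m [mmax sm]] := @maximal_ideal_above _ (Ideal s0 sD sM).
  by case=> h hE; apply: nsplit; exists h => v; rewrite hE scale1r.
have [m1 _] := mmax.
exists m; split=> //; exists n, q, psi; apply: contrapT => nv.
(* Where all [psi j (d v)] lie in [m], so does [phi i v]: otherwise a multiple of [phi i] would
   serve as the excluded [lam]. *)
have phi_span i : exists c : nat -> A, forall v,
    ideal_set m ((phi i v : A) - \sum_(j < n) c j * psi j (d v)).
  pose psi' j : {linear P -> A^o} :=
    if insub j is Some j' then psi j' \o d else \0.
  have psi'E (j : 'I_n) v : psi' j v = psi j (d v) by rewrite /psi' valK.
  have [v psiv|c cP] := @functional_span _ m P psi' n (phi i) mmax.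
    apply: contrapT => mv; have [t tP] := maximal_ideal_inv mmax mv.
    apply: nv; exists v, (t \*: phi i); split=> // j.
    by rewrite -psi'E; apply: psiv.
  by exists c => v; under eq_bigr do rewrite -psi'E; apply: cP.
have [c cP] := choice phi_span.
have [h hdef] : exists h : {linear Q -> P},
    forall w, h w = \sum_(j < n) (psi j w : A) *: \sum_i c i j *: g i.
  by exists (dual_comb_fun psi (fun j => \sum_i c i j *: g i)).
have phiE l v : (phi l v : A) = \sum_i phi l (g i) * phi i v.
  by rewrite {1}(gE v) linear_sum; apply: eq_bigr => i _; rewrite linearZ mulrC.
have hE l v : ideal_set m ((phi l (h (d v)) : A) - phi l v).
  have -> : (phi l (h (d v)) : A) =
      \sum_i phi l (g i) * \sum_(j < n) c i j * psi j (d v).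
    under [RHS]eq_bigr do rewrite mulr_sumr.
    rewrite exchange_big hdef linear_sum; apply: eq_bigr => j _.
    rewrite linearZ linear_sum /= scaler_sumr; apply: eq_bigr => i _.
    by rewrite linearZ /= /GRing.scale /=; ring.
  rewrite phiE -sumrB; apply: ideal_sum => i _; rewrite -mulrBr -opprB mulrN.
  by rewrite -mulN1r; do 2!apply: ideal_M.
(* As the [g k] need not be a basis, the identity of [P] can be represented by the identity matrix;
   adding the entries of [h d - 1] gives a matrix of [h d] congruent to 1 modulo [m]. *)
pose M := \matrix_(l, k) ((l == k)%:R + (phi l (h (d (g k))) - phi l (g k))).
have ME l v : phi l (h (d v)) = \sum_k M l k * phi k v.
  under eq_bigr do rewrite mxE mulrDl mulrBl.
  rewrite big_split sumrB /= -phiE (bigD1 l) //= eqxx mul1r big1 ?addr0.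
    rewrite addrCA subrr addr0 {1}(gE v) !linear_sum; apply: eq_bigr => k _.
    by rewrite !linearZ mulrC.
  by move=> k; rewrite eq_sym => /negPf->; rewrite mul0r.
have detM : ideal_set m (\det M - 1).
  rewrite -(det1 A p); apply: ideal_det => i j; rewrite !mxE.
  by rewrite addrAC subrr add0r; apply: hE.
apply: m1; rewrite -[1](subKr (\det M)); apply: idealB => //; apply: sm.
(* The adjugate of [M], applied after [h d], is multiplication by [\det M]. *)
exists (dual_comb_fun phi (fun i => \sum_l \adj M l i *: g l) \o h) => v.
rewrite /= /dual_comb_fun [in RHS](gE v) scaler_sumr.
under eq_bigr do rewrite scaler_sumr; rewrite exchange_big.
apply: eq_bigr => l _; under eq_bigr do rewrite scalerA.
rewrite -scaler_suml scalerA; congr (_ *: _).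
under eq_bigr do rewrite ME mulr_suml.
rewrite exchange_big (bigD1 l) //=.
have adjE k : \sum_i M i k * phi k v * \adj M l i = (\adj M *m M) l k * phi k v.
  by rewrite mxE mulr_suml; apply: eq_bigr => i _; ring.
rewrite adjE mul_adj_mx mxE eqxx big1 ?addr0 // => k kl.
by rewrite adjE mul_adj_mx mxE eq_sym (negPf kl) mul0r.
Qed.

End Minimality.

(** * Vanishing along a resolution *)

Section ResolutionGrade.
Variables (A : comPzRingType) (n : nat) (z : 'I_n -> A).
Variables (P : nat -> lmodType A) (d : forall i, {linear P i.+1 -> P i}).
Hypothesis dE : forall i, exact_at (d i.+1) (d i).
Local Notation kface := (kface [set: 'I_n]).
Local Notation kvanish := (kvanish z [set: 'I_n]).

(* A staircase in the double complex whose columns are the cochain complexes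
   of the [P i]. *)
Lemma koszul_staircase q : (forall i p, (p <= q)%N -> kvanish (P i) p) ->
  forall j, (q <= j)%N ->
  forall (psi : {set 'I_n} -> P j.+1) (phi : {set 'I_n} -> P j.+2),
  {in kface q.+1, forall S, kdiff z psi S = d j.+1 (phi S)} ->
  exists (a : {set 'I_n} -> P j.+2) (b : {set 'I_n} -> P j.+1),
    {in kface q, forall S, psi S = d j.+1 (a S) + kdiff z b S}.
Proof.
have dd i y : d i (d i.+1 y) = 0 by apply/dE; exists y.
(* [d psi] is a cocycle because [d d = 0], hence a coboundary of some [psi']. The pair [psi'], [psi]
   is then the same problem one degree and one column lower. *)
elim: q => [|q IHq] vP j qj psi phi psiE;
  have [S Sq|psi' psi'E] := vP j _ (leqnn _) (fun S => d j (psi S));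
  try by rewrite -kdiff_map psiE // dd.
  have /choice[a aE] S : exists y, S \in kface 0 -> d j.+1 y = psi S.
    case: (boolP (S \in kface 0)) => [S0|_]; last by exists 0.
    have /dE[y yE] : d j (psi S) = 0 by rewrite psi'E // (kface0 S0) kdiff_set0.
    by exists y.
  by exists a, (fun=> 0) => S S0; rewrite aE // (kface0 S0) kdiff_set0 addr0.
case: j qj psi phi psiE psi' psi'E => // j qj psi phi psiE psi' psi'E.
have [i p pq|S Sq|a [b abE]] := IHq _ j qj psi' psi.
- by apply: vP; apply: leqW.
- by rewrite psi'E.
have /choice[c cE] S : exists y, S \in kface q.+1 ->
    d j.+2 y = psi S - kdiff z a S.
  case: (boolP (S \in kface q.+1)) => [Sq|_]; last by exists 0.
  have /dE[y yE] : d j.+1 (psi S - kdiff z a S) = 0.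
    rewrite linearB psi'E // kdiff_map.
    rewrite (@kdiff_ext _ _ _ _ psi' (fun T => 1 *: d j.+1 (a T) + kdiff z b T)).
      by rewrite kdiff_lin scale1r kdiffK addr0 subrr.
    by move=> i iS; rewrite scale1r abE //; apply: kface_D1.
  by exists y.
by exists c, a => S Sq; rewrite cE // subrK.
Qed.

(** Injectivity of H^g(P_{k+1}) -> H^g(P_k). The staircase writes [psi] as [d a] plus a coboundary,
    so [d phi = d (kdiff z a)], and [d k] is injective because [P k.+2 = 0]. *)
Lemma koszul_injective k g : (forall y : P k.+2, y = 0) ->
  (forall i p, (p < g)%N -> kvanish (P i) p) -> (g <= k)%N ->
  forall (phi : {set 'I_n} -> P k.+1) (psi : {set 'I_n} -> P k),
  {in kface g, forall S, d k (phi S) = kdiff z psi S} ->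
  exists c, {in kface g, phi =1 kdiff z c}.
Proof.
move=> Pk2 vP gk phi psi phiE.
have d_inj : injective (d k).
  move=> y y' yy'; apply/eqP; rewrite -subr_eq0.
  have /dE[t <-] : d k (y - y') = 0 by rewrite linearB yy' subrr.
  by rewrite (Pk2 t) linear0.
case: g => [|g] in vP gk phiE *.
  exists (fun=> 0) => S S0; apply: d_inj.
  by rewrite phiE // (kface0 S0) !kdiff_set0 linear0.
case: k => // k in Pk2 gk phi psi phiE d_inj *.
have [S Sg|a [b abE]] := koszul_staircase vP gk (psi := psi) (phi := phi).
  by rewrite phiE.
exists a => S Sg; apply: d_inj; rewrite phiE // kdiff_map.
rewrite (@kdiff_ext _ _ _ _ psi (fun T => 1 *: d k.+1 (a T) + kdiff z b T)).
  by rewrite kdiff_lin scale1r kdiffK addr0.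
by move=> i iS; rewrite scale1r abE //; apply: kface_D1.
Qed.

End ResolutionGrade.

(** Membership in the radical of the ideal generated by [z]. *)
Definition radical_span (A : comPzRingType) n (z : 'I_n -> A) (a : A) :=
  exists e (c : 'I_n -> A), a ^+ e = \sum_i c i * z i.

(* If each [x j] acts nilpotently modulo [W], repeated multiplication reduces
   to elements whose products with all the [x j] lie in [W]. *)
Lemma nilpotent_closure (A : comPzRingType) (M : lmodType A) (W Z : M -> Prop)
    b (x : nat -> A) :
  (forall a y, Z y -> Z (a *: y)) -> (forall a y, W y -> W (a *: y)) ->
  (forall y, Z y -> (forall j, (j < b)%N -> W (x j *: y)) -> W y) ->
  (forall j, (j < b)%N -> exists e, forall y, Z y -> W (x j ^+ e *: y)) ->
  forall y, Z y -> W y.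
Proof.
move=> ZZ WZ Wx Wnil.
suff H i : (i <= b)%N -> forall y, Z y ->
    (forall j, (i <= j < b)%N -> W (x j *: y)) -> W y.
  move=> y Zy; apply: (H b) => // j /andP[bj jb].
  by have := leq_ltn_trans bj jb; rewrite ltnn.
elim: i => [|i IHi] ib y Zy Wy; first by apply: Wx => // j jb; apply: Wy.
have [e We] := Wnil i ib.
(* The exponent of [x i] is lowered one at a time from [e] to 0. *)
suff He l : (l <= e)%N -> W (x i ^+ (e - l) *: y).
  by have := He e (leqnn e); rewrite subnn expr0 scale1r.
elim: l => [|l IHl] le; first by rewrite subn0; apply: We.
apply: (IHi (ltnW ib)); first exact: ZZ.
move=> j /andP[]; rewrite leq_eqVlt => /orP[/eqP<- _|ij jb].
  by rewrite scalerA -exprS subnSK //; apply: IHl; apply: ltnW.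
by rewrite scalerA mulrC -scalerA; apply/WZ/Wy/andP.
Qed.

Lemma resolution_grade (A : comPzRingType) (P : nat -> lmodType A)
    (d : forall i, {linear P i.+1 -> P i}) k :
  (forall i, (i <= k.+1)%N -> fg_projective (P i)) ->
  (forall i, (k.+1 < i)%N -> forall y : P i, y = 0) ->
  (forall i, exact_at (d i.+1) (d i)) ->
  forall b (q : 'I_b -> P k) (psi : 'I_b -> {linear P k -> A^o}) v
    (lam : {linear P k.+1 -> A^o}),
  (forall w, w = \sum_j (psi j w : A) *: q j) ->
  forall n (z : 'I_n -> A),
  (forall j, radical_span z (psi j (d k v))) -> radical_span z (1 - lam v) ->
  forall g, (g <= k)%N -> kvanish z [set: 'I_n] A^o g.
Proof.
move=> Pfg P0 dE b q psi v lam qE n z zpsi zlam g.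
elim/ltn_ind: g => g IHg gk.
have vP i p : (p < g)%N -> kvanish z [set: 'I_n] (P i) p.
  move=> pg; case: (leqP i k.+1) => ik; last first.
    by move=> c _; exists (fun=> 0) => S _; rewrite (P0 i ik (c S)); apply/esym/P0.
  have [m [h [phi hE]]] := dual_basis (Pfg i ik).
  by apply: kvanish_dual_basis hE _; apply: IHg => //; apply: leq_trans (ltnW pg) gk.
(* Cocycles and coboundaries, taken among finite functions so that they live in a module. *)
pose Z (c : {ffun {set 'I_n} -> A^o}) :=
  {in kface [set: 'I_n] g.+1, forall S, kdiff z c S = 0}.
pose W (c : {ffun {set 'I_n} -> A^o}) :=
  exists c', {in kface [set: 'I_n] g, c =1 kdiff z c'}.
pose x j : A := if insub j is Some j' then psi j' (d k v) else 1 - lam v.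
have WD a c c' : W c -> W c' -> W (a *: c + c').
  move=> [t tE] [t' t'E]; exists (fun S => a *: t S + t' S) => S Sg.
  by rewrite !ffunE tE // t'E // kdiff_lin.
have ZZ a c : Z c -> Z (a *: c).
  move=> Zc S Sg; rewrite (@kdiff_ext _ _ _ _ _ (fun S => a *: c S + 0)).
    rewrite kdiff_lin Zc // scaler0 add0r.
    by rewrite /kdiff big1 // => i _; rewrite scaler0.
  by move=> i _; rewrite !ffunE addr0.
have W0 : W 0.
  exists (fun=> 0) => S _; rewrite ffunE.
  by rewrite /kdiff big1 // => i _; rewrite scaler0.
suff ZW c : Z c -> W c.
  move=> c c0; have [|c' c'E] := ZW (finfun c).
    by move=> S Sg; rewrite -(c0 S Sg); apply: kdiff_ext => i _; rewrite ffunE.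
  by exists c' => S Sg; rewrite -c'E // ffunE.
apply: (@nilpotent_closure _ _ W Z b.+1 x) => //.
- by move=> a y Wy; rewrite -[_ *: _]addr0; apply: WD.
- move=> {}c Zc Wx.
  have Wpsi j : W ((psi j (d k v) : A) *: c).
    by have := Wx j (ltnW (ltn_ord j)); rewrite /x valK.
  have Wlam : W ((1 - lam v : A) *: c).
    by have := Wx b (ltnSn b); rewrite /x insubF ?ltnn.
  have /choice[t tE] := Wpsi.
  (* [d (c v)] is the sum of the [psi j (d v) c] times [q j], a coboundary by assumption on [c]; so
     [c v] is a coboundary too. *)
  have [y|S Sg|a aE] := @koszul_injective _ _ z P d dE k g _ vP gk
      (fun S => (c S : A) *: v) (fun S => \sum_j (t j S : A) *: q j).
  + exact: P0.
  + rewrite linearZ /= [d k v]qE scaler_sumr /kdiff.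
    under [RHS]eq_bigr do rewrite scaler_sumr.
    rewrite exchange_big; apply: eq_bigr => j _.
    under eq_bigr do rewrite scalerA.
    rewrite -scaler_suml scalerA; congr (_ *: _).
    by have := tE j S Sg; rewrite !ffunE mulrC.
  (* The first summand is [lam (c v)], the second a coboundary by assumption. *)
  have -> : c = 1 *: [ffun S => (c S : A) * lam v : A^o] + (1 - lam v : A) *: c.
    by apply/ffunP=> S; rewrite !ffunE scale1r /GRing.scale /=; ring.
  apply: (WD 1) Wlam; exists (fun S => lam (a S)) => S Sg.
  by rewrite ffunE -kdiff_map -aE // linearZ.
- move=> j _.
  have [e [a aE]] : radical_span z (x j) by rewrite /x; case: insub.
  exists e => y Zy; have [t tE] := kcoboundary_ideal a Zy.
  exists t => S Sg; rewrite ffunE aE -tE //; congr (_ *: _).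
  by apply: eq_bigl => i; rewrite inE.
Qed.

Lemma projdim_le_grade (A : comPzRingType) (N : lmodType A) :
  has_finite_projective_resolution N ->
  exists k, (projdim N <= ENat k)%O /\ ((0 < k)%N ->
    exists m : ideal A, maximal_ideal m /\
    exists b (x : 'I_b -> A), (forall j, ideal_set m (x j)) /\
      forall n (z : 'I_n -> A), (forall j, radical_span z (x j)) ->
      forall p, (p < k)%N -> kvanish z [set: 'I_n] A^o p).
Proof.
case=> k0 Nk0.
(* The [k] sought is the minimal length of a resolution by finitely generated projectives; by
   [resolution_shorten] its last map does not split. *)
have exk : exists k, `[< has_resolution (@fg_projective A) N k >].
  by exists k0; apply/asboolP.
case: (ex_minnP exk) => k /asboolP Nk kmin; exists k; split.
  apply: einf_lb; exists k => //.
  have [P [d [e [Pfg P0 es dE dS]]]] := Nk.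
  by exists P, d, e; split=> // i /Pfg[].
case: k Nk kmin => // k [P [d [e [Pfg P0 es dE dS]]]] kmin _.
have [|||m [mmax [b [q [psi [v [lam [qE mpsi mlam]]]]]]]] :=
    nonsplit_minimal (d := d k).
- exact: Pfg.
- exact: Pfg.
- move=> split_d; suff : (k.+1 <= k)%N by rewrite ltnn.
  by apply: kmin; apply/asboolP; apply: resolution_shorten split_d.
pose x (j : 'I_b.+1) : A :=
  if unlift ord_max j is Some i then psi i (d k v) else 1 - lam v.
exists m; split=> //; exists b.+1, x; split=> [j|n z zx p pk].
  by rewrite /x; case: unlift.
apply: (resolution_grade Pfg P0 dS (v := v) (lam := lam) qE) => // [j|].
  by have := zx (lift ord_max j); rewrite /x liftK.
by have := zx ord_max; rewrite /x unlift_none.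
Qed.

Lemma enat_le_nat (a b : enat) :
  (forall k, (ENat k <= a)%O -> (ENat k <= b)%O) -> (a <= b)%O.
Proof.
case: a b => [k|] [l|] // ab; first exact: ab.
by have := ab l.+1 isT; rewrite /Order.le /= ltnn.
Qed.

(** * Koszul grade of an ideal *)

Section KoszulGrade.
Variable A : comPzRingType.
Implicit Types (m : ideal A) (N : lmodType A).

Lemma Kgrade_ge m N n (x : 'I_n -> A) k : (forall j, ideal_set m (x j)) ->
  (forall p, (p < k)%N -> kvanish x [set: 'I_n] N p) -> (ENat k <= Kgrade m N)%O.
Proof.
move=> mx /Kgrade_seq_ge vN; apply: le_trans vN _; apply: esup_ub.
have gI : generates (span_ideal x) x by [].
exists (span_ideal x); split; [by exists n, x | exact: span_ideal_sub | by exists n, x].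
Qed.

(** A supremum of extended naturals that is at least [k.+1] is not bounded by [k], so some member
    already reaches [k.+1]. *)
Lemma Kgrade_geP m N k : (ENat k <= Kgrade m N)%O ->
  exists n (x : 'I_n -> A), (forall j, ideal_set m (x j)) /\
    forall p, (p < k)%N -> kvanish x [set: 'I_n] N p.
Proof.
case: k => [_|k kN]; first by exists 0, (fun=> 0); split=> // -[].
apply: contrapT => nx; suff : (Kgrade m N <= ENat k)%O.
  by move=> /(le_trans kN); rewrite /Order.le /= ltnn.
apply: esup_least => _ [I [_ Im [n [x [gI ->]]]]].
rewrite leNgt; apply/negP => kx; apply: nx; exists n, x; split.
  by move=> j; apply: Im; apply/gI; apply: span_ideal_gen.
apply/Kgrade_seq_ge; case: (Kgrade_seq x N) kx => // l.
by rewrite lt_def /Order.le /= => /andP[lk kl]; rewrite ltn_neqAle kl andbT;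
   apply: contraNneq lk => ->.
Qed.

(** Enlarging a sequence preserves vanishing below [k]; one sequence can thus witness the grades of
    two modules at once. *)
Lemma kvanish_concat n n' (x : 'I_n -> A) (y : 'I_n' -> A) :
  exists z : 'I_(n + n')%N -> A,
  [/\ forall i, (exists j, z i = x j) \/ (exists j, z i = y j),
      forall N k, (forall p, (p < k)%N -> kvanish x [set: 'I_n] N p) ->
        forall p, (p < k)%N -> kvanish z [set: 'I_(n + n')%N] N p
    & forall N k, (forall p, (p < k)%N -> kvanish y [set: 'I_n'] N p) ->
        forall p, (p < k)%N -> kvanish z [set: 'I_(n + n')%N] N p].
Proof.
pose z i := match split i with inl j => x j | inr j => y j end.
exists z; split=> [i|M k vM p pk|M k vM p pk].
- by rewrite /z; case: split => j; [left | right]; exists j.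
  apply: (kvanish_subset (finset.subsetT (lshift n' @: [set: 'I_n])) _ pk).
  move=> {pk}p pk; apply: kvanish_imset => //.
  rewrite (_ : z \o _ = x); first exact: vM.
  by apply/funext => i; rewrite /z /= (unsplitK (inl i)).
apply: (kvanish_subset (finset.subsetT (@rshift n n' @: [set: 'I_n'])) _ pk).
move=> {pk}p pk; apply: kvanish_imset => [i j|] /=; first by rewrite ltn_add2l.
rewrite (_ : z \o _ = y); first exact: vM.
by apply/funext => i; rewrite /z /= (unsplitK (inr i)).
Qed.

Lemma Kgrade_le_fPD m : maximal_ideal m -> (Kgrade m A^o <= fPD A)%O.
Proof.
move=> [m1 _]; apply: enat_le_nat => k /Kgrade_geP[n [x [mx vA]]].
by apply: fPD_ge vA => /(span_ideal_sub mx).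
Qed.

End KoszulGrade.

(** * The amalgamation *)

Section BaseChange.
Variables (A S : comPzRingType) (phi : {rmorphism A -> S}).
Variables (n : nat) (z : 'I_n -> A) (N : lmodType A) (M : lmodType S).

Lemma rmorph_ksign i (T : {set 'I_n}) : phi (ksign A i T) = ksign S i T.
Proof. by rewrite /ksign rmorphXn /= rmorphN1. Qed.

Lemma kdiff_restrict (h : M -> N) (c : {set 'I_n} -> M) T :
  zmod_morphism h -> (forall a y, h (phi a *: y) = a *: h y) ->
  h (kdiff (phi \o z) c T) = kdiff z (h \o c) T.
Proof.
move=> hB hZ; pose h' : {additive M -> N} :=
  HB.pack h (GRing.isZmodMorphism.Build M N h hB).
rewrite -[LHS]/(h' (kdiff _ _ _)) raddf_sum; apply: eq_bigr => i _ /=.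
by rewrite -hZ rmorphM rmorph_ksign.
Qed.

Lemma kdiff_extend_scalars (h : N -> M) (c : {set 'I_n} -> N) T :
  zmod_morphism h -> (forall a y, h (a *: y) = phi a *: h y) ->
  h (kdiff z c T) = kdiff (phi \o z) (h \o c) T.
Proof.
move=> hB hZ; pose h' : {additive N -> M} :=
  HB.pack h (GRing.isZmodMorphism.Build N M h hB).
rewrite -[LHS]/(h' (kdiff _ _ _)) raddf_sum; apply: eq_bigr => i _ /=.
by rewrite hZ rmorphM rmorph_ksign.
Qed.

(** [N] is a retract of [M] with scalars restricted along [phi]: a cocycle is pushed to [M] and its
    primitive pulled back. *)
Lemma kvanish_restrict D p (h : N -> M) (r : M -> N) :
  zmod_morphism h -> zmod_morphism r -> cancel h r ->
  (forall a y, h (a *: y) = phi a *: h y) ->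
  (forall a y, r (phi a *: y) = a *: r y) ->
  kvanish (phi \o z) D M p -> kvanish z D N p.
Proof.
move=> hB rB hK hZ rZ vM c c0; have [T Tp|c' c'E] := vM (h \o c).
  by rewrite -kdiff_extend_scalars // c0 // -(subrr 0) hB subrr.
by exists (r \o c') => T Tp; rewrite -kdiff_restrict // -c'E //= hK.
Qed.

End BaseChange.

Section AmalgamationModules.
Variables (A B : comPzRingType) (f : {rmorphism A -> B}) (J : ideal B).
Local Notation S := (amalgamation f J).
Local Notation JA := (ideal_module J f).

Fact amalg_diag_subproof a : (a, f a) \in amalg_pred f J.
Proof. by apply/asboolP; exists a, 0; rewrite addr0; split=> //; apply: ideal_0. Qed.

Definition amalg_diag a : S := Sub (a, f a) (amalg_diag_subproof a).

Fact amalg_diag_is_zmod_morphism : zmod_morphism amalg_diag.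
Proof.
by move=> a b; apply: val_inj; rewrite [RHS]raddfB /= rmorphB.
Qed.

Fact amalg_diag_is_monoid_morphism : monoid_morphism amalg_diag.
Proof.
split; first by apply: val_inj; rewrite [RHS]rmorph1 /= rmorph1.
by move=> a b; apply: val_inj; rewrite [RHS]rmorphM /= rmorphM.
Qed.

HB.instance Definition _ :=
  GRing.isZmodMorphism.Build A S amalg_diag amalg_diag_is_zmod_morphism.
HB.instance Definition _ :=
  GRing.isMonoidMorphism.Build A S amalg_diag amalg_diag_is_monoid_morphism.

Definition amalg_fst (s : S) : A := (val s).1.

Fact amalg_fst_is_zmod_morphism : zmod_morphism amalg_fst.
Proof. by move=> s t; rewrite /amalg_fst raddfB. Qed.

Fact amalg_fst_is_monoid_morphism : monoid_morphism amalg_fst.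
Proof. by split=> [|s t]; rewrite /amalg_fst ?rmorph1 ?rmorphM. Qed.

HB.instance Definition _ :=
  GRing.isZmodMorphism.Build S A amalg_fst amalg_fst_is_zmod_morphism.
HB.instance Definition _ :=
  GRing.isMonoidMorphism.Build S A amalg_fst amalg_fst_is_monoid_morphism.

Fact amalg_snd_subproof (s : S) :
  (val s).2 - f (amalg_fst s) \in ideal_pred J.
Proof.
have /asboolP[a [j [Jj sE]]] := valP s; apply/asboolP.
by rewrite /amalg_fst sE /= addrC addKr.
Qed.

Definition amalg_snd (s : S) : JA :=
  Sub ((val s).2 - f (amalg_fst s)) (amalg_snd_subproof s).

Fact amalg_snd_is_zmod_morphism : zmod_morphism amalg_snd.
Proof.
move=> s t; apply: val_inj; rewrite /= !raddfB /=; ring.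
Qed.

HB.instance Definition _ :=
  GRing.isZmodMorphism.Build S JA amalg_snd amalg_snd_is_zmod_morphism.

Fact amalg_incl_subproof (u : JA) : (0, val u) \in amalg_pred f J.
Proof.
apply/asboolP; exists 0, (val u); rewrite rmorph0 add0r; split=> //.
by apply/asboolP; apply: valP u.
Qed.

Definition amalg_incl (u : JA) : S := Sub (0, val u) (amalg_incl_subproof u).

Fact amalg_incl_is_zmod_morphism : zmod_morphism amalg_incl.
Proof.
move=> u v; apply: val_inj; rewrite [RHS]raddfB /=.
by rewrite [RHS]/GRing.add /= /add_pair /= subrr.
Qed.

HB.instance Definition _ :=
  GRing.isZmodMorphism.Build JA S amalg_incl amalg_incl_is_zmod_morphism.

Lemma amalg_diagK : cancel amalg_diag amalg_fst. Proof. by []. Qed.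

Lemma amalg_inclK : cancel amalg_incl amalg_snd.
Proof. by move=> u; apply: val_inj; rewrite /= rmorph0 subr0. Qed.

Lemma amalg_decomp s : s = amalg_diag (amalg_fst s) + amalg_incl (amalg_snd s).
Proof.
apply: val_inj; rewrite raddfD /= [RHS]/GRing.add /= /add_pair /= addr0.
by rewrite addrC subrK -surjective_pairing.
Qed.

End AmalgamationModules.

(** * Koszul vanishing and finitistic dimension of the amalgamation *)

Section AmalgamationGrade.
Variables (A B : comPzRingType) (f : {rmorphism A -> B}) (J : ideal B).
Local Notation S := (amalgamation f J).
Local Notation JA := (ideal_module J f).
Local Notation diag := (@amalg_diag A B f J).
Local Notation fst := (@amalg_fst A B f J).
Local Notation snd := (@amalg_snd A B f J).
Local Notation incl := (@amalg_incl A B f J).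

Lemma amalg_sndZ a s : snd (diag a * s) = a *: snd s.
Proof. by apply: val_inj; rewrite /= rmorphM mulrBr. Qed.

Lemma amalg_inclZ a u : incl (a *: u) = diag a * incl u.
Proof.
apply: val_inj; rewrite /= [RHS]/GRing.mul /= /mul_pair /=.
by rewrite mulr0.
Qed.

Lemma amalg_fst_comb n (t : 'I_n -> A) (x : 'I_n -> S) :
  fst (\sum_i diag (t i) * x i) = \sum_i t i * fst (x i).
Proof. by rewrite raddf_sum; apply: eq_bigr => i _; exact: (rmorphM fst). Qed.

Lemma kvanish_amalg n (z : 'I_n -> A) D p :
  kvanish (diag \o z) D S^o p <-> kvanish z D A^o p /\ kvanish z D JA p.
Proof.
pose i1 : A^o -> S^o := diag; pose r1 : S^o -> A^o := fst.
pose i2 : JA -> S^o := incl; pose r2 : S^o -> JA := snd.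
have i1Z a (y : A^o) : i1 (a *: y) = diag a *: i1 y by apply: rmorphM.
have i2Z a (y : JA) : i2 (a *: y) = diag a *: i2 y by apply: amalg_inclZ.
have r1Z a (y : S^o) : r1 (diag a *: y) = a *: r1 y by apply: rmorphM.
have r2Z a (y : S^o) : r2 (diag a *: y) = a *: r2 y by apply: amalg_sndZ.
have i1B : zmod_morphism i1 by exact: (@amalg_diag_is_zmod_morphism A B f J).
have i2B : zmod_morphism i2 by exact: (@amalg_incl_is_zmod_morphism A B f J).
have r1B : zmod_morphism r1 by exact: (@amalg_fst_is_zmod_morphism A B f J).
have r2B : zmod_morphism r2 by exact: (@amalg_snd_is_zmod_morphism A B f J).
split=> [vS|[vA vJ] c c0].
  split; first exact: kvanish_restrict i1B r1B _ i1Z r1Z vS.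
  exact: kvanish_restrict i2B r2B (@amalg_inclK _ _ f J) i2Z r2Z vS.
have [T Tp|c1 c1E] := vA (r1 \o c).
  by rewrite -(kdiff_restrict _ _ _ r1B r1Z) c0 // -(subrr 0) r1B subrr.
have [T Tp|c2 c2E] := vJ (r2 \o c).
  by rewrite -(kdiff_restrict _ _ _ r2B r2Z) c0 // -(subrr 0) r2B subrr.
exists (fun T => 1 *: i1 (c1 T) + i2 (c2 T)) => T Tp.
rewrite kdiff_lin scale1r -(kdiff_extend_scalars _ _ _ i1B i1Z).
rewrite -(kdiff_extend_scalars _ _ _ i2B i2Z).
by rewrite -c1E // -c2E //; apply: amalg_decomp.
Qed.

Hypothesis hJ : (J `<=` @nilradical B)%classic.

Lemma amalg_fst0_nilp s : fst s = 0 -> exists e, s ^+ e = 0.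
Proof.
move=> s0; have [e eE] : exists e, (val s).2 ^+ e = 0.
  apply: hJ; have /asboolP := amalg_snd_subproof s.
  by rewrite s0 rmorph0 subr0.
have valX e' : val (s ^+ e') = ((val s).1 ^+ e', (val s).2 ^+ e').
  by rewrite rmorphXn /=; elim: e' => // e' IH; rewrite exprS IH !exprS.
(* The exponent [e] may be 0, and the first component needs a positive power of 0. *)
exists e.+1; apply: val_inj; rewrite valX [(val s).1]s0 expr0n /=.
by rewrite exprS eE mulr0.
Qed.

Lemma fPD_amalg_le :
  (fPD S <= esup [set Order.min (Kgrade m A^o) (Kgrade m JA) | m in @Max A]%classic)%O.
Proof.
apply: esup_least => _ [N [/projdim_le_grade[k [Nk kP]] ->]].
apply: le_trans Nk _; case: k kP => [_|k /(_ isT)]; first by case: (esup _).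
move=> [m' [[m'1 _] [b [x [xm' xP]]]]].
pose a := fst \o x.
(* Since [x j - diag (a j)] is nilpotent, [x j ^+ e] is the difference of two [e]-th powers and so a
   multiple of [diag (a j)]. *)
have rad j : radical_span (diag \o a) (x j).
  have [|e eE] := @amalg_fst0_nilp (x j - diag (a j)).
    by rewrite raddfB /= amalg_diagK subrr.
  exists e; have := subrXX (x j) (x j - diag (a j)) e.
  rewrite eE subr0 subKr; set t := \sum_(i < e) _ => xe.
  exists (fun i => if i == j then t else 0).
  rewrite (bigD1 j) //= eqxx big1 ?addr0 ?xe 1?mulrC // => i /negPf->.
  by rewrite mul0r.
have vS := xP _ _ rad.
have [|m [mmax Im]] := @maximal_ideal_above _ (span_ideal a).
  (* If 1 were a combination of the [a i], then [1 - y] would be nilpotent with [y] in [m'], and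
     [1 = 1 - (1 - y) ^+ e] would be a multiple of [y]. *)
  case=> t one; pose y := \sum_i diag (t i) * x i.
  have m'y : ideal_set m' y by apply: ideal_sum => i _; apply: ideal_M.
  have [|e eE] := @amalg_fst0_nilp (1 - y).
    rewrite amalg_fst_is_zmod_morphism [fst 1](rmorph1 fst) amalg_fst_comb.
    by rewrite [X in X - _]one subrr.
  apply: m'1; have := subrXX 1 (1 - y) e.
  by rewrite eE expr1n subr0 subKr mulrC => ->; apply: ideal_M.
apply: le_trans (esup_ub _); last by exists m.
have am j : ideal_set m (a j) by apply: Im; apply: span_ideal_gen.
by rewrite le_min; apply/andP; split; apply: (Kgrade_ge am) => p /vS/kvanish_amalg[].
Qed.

Lemma min_Kgrade_le_fPD_amalg m : maximal_ideal m ->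
  (Order.min (Kgrade m A^o) (Kgrade m JA) <= fPD S)%O.
Proof.
move=> [m1 _]; apply: enat_le_nat => k; rewrite le_min => /andP[].
move=> /Kgrade_geP[n [x [mx vA]]] /Kgrade_geP[n' [y [my vJ]]].
have [z [zxy zA zJ]] := kvanish_concat x y.
apply: (fPD_ge (x := diag \o z)) => [[c one]|p pk].
  (* Projecting to [A] a relation that makes [diag \o z] generate the unit ideal would put 1 in
     [m]. *)
  apply: m1; rewrite -(rmorph1 fst) one.
  rewrite raddf_sum; apply: ideal_sum => i _.
  rewrite [X in ideal_set m X](rmorphM fst); apply: ideal_M.
  by rewrite [X in ideal_set m X]amalg_diagK; case: (zxy i) => -[j ->].
by apply/kvanish_amalg; split; [apply: zA pk | apply: zJ pk].
Qed.

End AmalgamationGrade.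

Local Open Scope classical_set_scope.

Theorem theorem7p2 (A B : comPzRingType) (f : {rmorphism A -> B}) (J : ideal B)
    (hJ : J `<=` @nilradical B) :
  fPD (amalgamation f J) =
    esup [set Order.min (Kgrade m A^o) (Kgrade m (ideal_module J f))
         | m in @Max A]
  /\
  (esup [set Order.min (Kgrade m A^o) (Kgrade m (ideal_module J f))
         | m in @Max A] <= fPD A)%O.
Proof.
split; last first.
  apply: esup_least => _ [m mmax <-].
  by rewrite ge_min (Kgrade_le_fPD mmax).
apply: le_anti; rewrite fPD_amalg_le //=.
apply: esup_least => _ [m mmax <-].
exact: min_Kgrade_le_fPD_amalg.
Qed.
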